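(* Let $f:\mathbb{R}\to\mathbb{R}$ be smooth and of bistable type: there is $\alpha\in(0,1)$ with $f(0)=f(\alpha)=f(1)=0$, $f'(0)<0$, $f'(1)<0$, $f'(\alpha)>0$, $f(u)>0$ for $u\in(-\infty,0)\cup(\alpha,1)$ and $f(u)<0$ for $u\in(0,\alpha)\cup(1,+\infty)$. Let $$0<\tau<\tau_m:=\frac{1}{\sup_{u\in[0,1]}|f'(u)|}.$$ Then there exists a unique value $c_\ast\in(-1/\sqrt{\tau},1/\sqrt{\tau})$ for which the system $$u_t=v_x+f(u),\qquad \tau v_t=u_x-v,\qquad (x,t)\in\mathbb{R}\times\mathbb{R}_+,$$ possesses a traveling wave $(u,v)(x,t)=(U,V)(x-c_\ast t)$ connecting the state $(0,0)$ to $(1,0)$, i.e. with $(U,V)(-\infty)=(0,0)$ and $(U,V)(+\infty)=(1,0)$. Moreover: (a) the function $U$ is monotone increasing; (b) both components $U$ and $V$ are positive and converge to their asymptotic states exponentially fast; (c) the speed $c_\ast=c_\ast(\tau)$ depends continuously on $\tau\in(0,\tau_m)$ and converges, as $\tau\to0^+$, to the speed of the traveling front connecting $0$ to $1$ of the parabolic Allen--Cahn equation $u_t=u_{xx}+f(u)$.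
   Context: A traveling wave with speed $c$ is a solution of the form $(u,v)(x,t)=(U,V)(\xi)$, $\xi=x-ct$; equivalently $(U,V)$ solves $cU'+V'+f(U)=0$, $U'+c\tau V'-V=0$. *)

(* Defs.v *)
From Stdlib Require Import Reals.
From Coquelicot Require Import Coquelicot.
Open Scope R_scope.

Definition smooth (f : R -> R) : Prop := forall (n : nat) (x : R), ex_derive_n f n x.

Definition bistable (f : R -> R) (alpha : R) : Prop :=
  0 < alpha < 1 /\
  f 0 = 0 /\ f alpha = 0 /\ f 1 = 0 /\
  Derive f 0 < 0 /\ Derive f 1 < 0 /\ Derive f alpha > 0 /\
  (forall u, u < 0 -> f u > 0) /\
  (forall u, alpha < u < 1 -> f u > 0) /\
  (forall u, 0 < u < alpha -> f u < 0) /\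
  (forall u, 1 < u -> f u < 0).

Definition sup_abs_deriv01 (f : R -> R) : Rbar :=
  Lub_Rbar (fun y => exists u, 0 <= u <= 1 /\ y = Rabs (Derive f u)).

Definition tau_m (f : R -> R) : R := 1 / real (sup_abs_deriv01 f).

(* (U,V) is a traveling wave with speed c for u_t = v_x + f(u), tau v_t = u_x - v,
   i.e. c U' + V' + f(U) = 0 and U' + c tau V' - V = 0, connecting (0,0) at -oo
   to (1,0) at +oo. *)
Definition hyp_front (f : R -> R) (tau c : R) (U V : R -> R) : Prop :=
  (forall x, ex_derive U x /\ ex_derive V x /\
     c * Derive U x + Derive V x + f (U x) = 0 /\
     Derive U x + c * tau * Derive V x - V x = 0) /\
  is_lim U m_infty 0 /\ is_lim V m_infty 0 /\
  is_lim U p_infty 1 /\ is_lim V p_infty 0.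

(* U is a traveling front with speed c of the Allen--Cahn equation u_t = u_xx + f(u),
   i.e. U'' + c U' + f(U) = 0, with U(-oo) = 0, U(+oo) = 1. *)
Definition parabolic_front (f : R -> R) (c : R) (U : R -> R) : Prop :=
  (forall x, ex_derive U x /\ ex_derive (Derive U) x /\
     Derive (Derive U) x + c * Derive U x + f (U x) = 0) /\
  is_lim U m_infty 0 /\ is_lim U p_infty 1.

Definition exp_converges (U V : R -> R) : Prop :=
  exists C mu : R, 0 < C /\ 0 < mu /\
    (forall x, x <= 0 -> Rabs (U x) + Rabs (V x) <= C * exp (mu * x)) /\
    (forall x, 0 <= x -> Rabs (U x - 1) + Rabs (V x) <= C * exp (- (mu * x))).

(* Main.v *)
Require Import Defs.
From Stdlib Require Import Reals Lra ClassicalEpsilon.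
From Coquelicot Require Import Coquelicot.
Open Scope R_scope.

(** With [k = 1 - c^2 tau], [s = c / sqrt k] and [x = sqrt k y], a front solves
    [U'' + m(U) U' + f(U) = 0] with damping [m = s (1 - tau f')]; the parabolic front is the
    case [tau = 0].  Writing [U' = p(U)] turns this into [p' = - m - f / p] on [(0,1)] with
    [p = 0] at both ends.  Let [alpha] be the middle zero of [f].  For every [s] there is a
    solution on [(0,alpha)] vanishing at 0, obtained as the limit [e -> 0] of
    [p' = - m + (e - f) / p] above the subsolution [mu (e - f)], and by reflection a solution on
    [(alpha,1)] vanishing at 1.  Their values at [alpha] are Lipschitz and move in opposite
    directions with [s], so they match for some [s].

    An arbitrary front stays in [(0,1)] and is compared with a profile of damping [m2] through
    [D = U' - p(U)], which satisfies [D' = U' (m2 - m) + f D / p] and vanishes at both infinities.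
    Since [f] is negative below [alpha] and positive above, [m < m2] and [m > m2] are both
    impossible, while [m = m2] forces [U' = p(U)].  This gives uniqueness of the speed,
    monotonicity and the exponential rates; applied at two nearby delays it gives continuity of
    the speed, down to [tau = 0]. *)

(** The equation for p is singular where p vanishes, hence at both end states, and no existence
    theorem for Lipschitz fields starts a solution there. Adding e > 0 to -f lifts the starting
    value; what survives as e -> 0 is a bound on p' and a lower barrier, both independent of e. The
    two sides of alpha are treated separately because the singular term damps the difference of two
    solutions as u increases from 0 where f < 0, and as u decreases from 1 where f > 0.

    The condition tau < tau_m bounds 1 - tau f' below by a positive constant on [0,1]. Dampings with
    different s are then strictly ordered at every state, which makes the matching monotone and the
    comparison decisive.

    An arbitrary front is not known to be monotone, so its slope cannot be treated as a function of
    its state; D follows the front along its own orbit instead. Statements at the end state 1 come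
    from those at 0 through x -> -x, U -> 1 - U. *)

Lemma choice (A B : Type) (P : A -> B -> Prop) :
  (forall x, exists y, P x y) -> exists g : A -> B, forall x, P x (g x).
Proof.
  intros h. exists (fun x => proj1_sig (constructive_indefinite_description _ (h x))).
  intros x. apply proj2_sig.
Qed.

(** * Barrier arguments and limits of derivatives *)

(** Differentiability is asked on the open interval only: a profile is continuous up to the end
    states, but its equation is singular there. *)
Lemma MVT_open (phi dphi : R -> R) (a b : R) :
  a < b ->
  (forall x, a <= x <= b -> continuous phi x) ->
  (forall x, a < x < b -> is_derive phi x (dphi x)) ->
  exists c, a < c < b /\ phi b - phi a = dphi c * (b - a).
Proof.
  intros hab hc hd.
  assert (pr1 : forall c, a < c < b -> derivable_pt phi c).
  { intros c hc'. exists (dphi c). apply is_derive_Reals. now apply hd. }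
  assert (pr2 : forall c, a < c < b -> derivable_pt id c).
  { intros c _. apply derivable_pt_id. }
  destruct (MVT phi id a b pr1 pr2 hab) as (c & P & E).
  - intros c Hc. apply continuity_pt_filterlim. now apply hc.
  - intros c _. apply derivable_continuous_pt, derivable_pt_id.
  - exists c. split; [exact P|].
    rewrite (derive_pt_eq_0 _ _ 1 (pr2 c P)) in E by apply derivable_pt_lim_id.
    rewrite (derive_pt_eq_0 _ _ (dphi c) (pr1 c P)) in E by (apply is_derive_Reals; now apply hd).
    unfold id in E. lra.
Qed.

Lemma first_zero (phi : R -> R) (a b : R) :
  a <= b -> (forall x, a <= x <= b -> continuous phi x) ->
  0 < phi a -> phi b <= 0 ->
  exists c, a < c <= b /\ phi c = 0 /\ (forall x, a <= x < c -> 0 < phi x).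
Proof.
  intros hab hc ha hb.
  set (E := fun x => a <= x <= b /\ forall y, a <= y <= x -> 0 < phi y).
  assert (Ea : E a).
  { split; [lra|]. intros y Hy. replace y with a by lra. exact ha. }
  destruct (completeness E) as [c [ub lub]].
  { exists b. intros x [Hx _]. lra. }
  { now exists a. }
  assert (hac : a <= c) by now apply ub.
  assert (hcb : c <= b) by (apply lub; intros x [Hx _]; lra).
  assert (below : forall x, a <= x < c -> 0 < phi x).
  { intros x Hx. apply Rnot_le_lt. intros Hn.
    assert (c <= x); [|lra]. apply lub. intros y [Hy1 Hy2].
    apply Rnot_lt_le. intros Hxy.
    assert (0 < phi x) by (apply Hy2; lra). lra. }
  assert (cc : continuous phi c) by (apply hc; lra).
  destruct (Rtotal_order (phi c) 0) as [Hneg|[H0|Hpos]].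
  - assert (P : 0 < - phi c) by lra.
    destruct (proj1 (filterlim_locally phi (phi c)) cc (mkposreal _ P)) as [d Hd].
    assert (a < c).
    { destruct (Rle_lt_or_eq_dec _ _ hac) as [|e]; [easy|]. rewrite e in ha. lra. }
    set (x := Rmax a (c - d / 2)).
    assert (Hd0 := cond_pos d).
    assert (Hx : a <= x < c).
    { unfold x. split; [apply Rmax_l|]. apply Rmax_lub_lt; lra. }
    assert (c - d/2 <= x) by apply Rmax_r.
    specialize (Hd x). assert (B : ball c d x).
    { unfold ball; simpl; unfold AbsRing_ball, abs, minus, plus, opp; simpl.
      rewrite Rabs_left1; lra. }
    specialize (Hd B). specialize (below x Hx).
    unfold ball in Hd; simpl in Hd; unfold AbsRing_ball, abs, minus, plus, opp in Hd; simpl in Hd.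
    apply Rabs_def2 in Hd. lra.
  - exists c. split; [|now split].
    split; [|easy]. destruct (Rle_lt_or_eq_dec _ _ hac) as [|e]; [easy|]. rewrite e in ha. lra.
  - destruct (proj1 (filterlim_locally phi (phi c)) cc (mkposreal _ Hpos)) as [d Hd].
    assert (Hd0 := cond_pos d).
    assert (c < b).
    { destruct (Rle_lt_or_eq_dec _ _ hcb) as [|e]; [easy|]. rewrite <- e in hb. lra. }
    set (x := Rmin b (c + d / 2)).
    assert (Hx : c < x) by (unfold x; apply Rmin_glb_lt; lra).
    assert (x <= b) by apply Rmin_l. assert (x <= c + d / 2) by apply Rmin_r.
    assert (Ex : E x).
    { split; [lra|]. intros y Hy. destruct (Rlt_dec y c) as [Hyc|Hyc].
      - apply below; lra.
      - assert (B : ball c d y).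
        { unfold ball; simpl; unfold AbsRing_ball, abs, minus, plus, opp; simpl.
          rewrite Rabs_right; lra. }
        specialize (Hd y B).
        unfold ball in Hd; simpl in Hd; unfold AbsRing_ball, abs, minus, plus, opp in Hd; simpl in Hd.
        apply Rabs_def2 in Hd. lra. }
    assert (x <= c) by now apply ub. lra.
Qed.

(** If [phi b] exceeded the bound, [phi - K (x - a)] would be positive from its last zero up to [b],
    so [phi] would be positive there too and the derivative bound would forbid the increase.
    Restricting that bound to points where [phi] is positive lets a singular term with a sign be
    discarded. *)
Lemma barrier (phi dphi : R -> R) (a b K : R) :
  a <= b -> 0 <= K ->
  (forall x, a <= x <= b -> continuous phi x) ->
  (forall x, a < x < b -> is_derive phi x (dphi x)) ->
  phi a <= 0 ->
  (forall x, a < x < b -> 0 < phi x -> dphi x <= K) ->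
  phi b <= K * (b - a).
Proof.
  intros hab hK hc hd ha hb. apply Rnot_lt_le. intros Hn.
  set (psi := fun x => phi x - K * (x - a)).
  assert (cpsi : forall x, a <= x <= b -> continuous psi x).
  { intros x Hx. apply (continuous_minus phi (fun x => K * (x - a))); [now apply hc|].
    apply (@ex_derive_continuous R_AbsRing R_NormedModule). auto_derive. trivial. }
  (* Under x -> -x the first zero becomes the last zero before [b]. *)
  destruct (first_zero (fun x => psi (- x)) (- b) (- a)) as (c & Hc & E & P).
  - lra.
  - intros x Hx. apply continuous_comp.
    + apply (@continuous_opp R_UniformSpace R_AbsRing R_NormedModule), continuous_id.
    + apply cpsi. lra.
  - rewrite Ropp_involutive. unfold psi. lra.
  - rewrite Ropp_involutive. unfold psi.
    replace (a - a) with 0 by ring. lra.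
  - destruct (MVT_open psi (fun x => dphi x - K) (- c) b) as (xi & Hxi & EM).
    + lra.
    + intros x Hx. apply cpsi. lra.
    + intros x Hx. unfold psi. evar_last.
      * apply (is_derive_minus phi (fun x => K * (x - a)) x (dphi x) K).
        -- apply hd; lra.
        -- auto_derive; trivial. ring.
      * reflexivity.
    + assert (Q : 0 < psi xi).
      { rewrite <- (Ropp_involutive xi). apply P. lra. }
      unfold psi in Q. assert (dphi xi <= K).
      { apply hb; [lra|]. assert (0 <= K * (xi - a)); [|lra]. apply Rmult_le_pos; lra. }
      assert (0 < psi b) by (unfold psi; lra).
      rewrite E in EM. nra.
Qed.

Lemma is_lim_m_infty_bound (phi : R -> R) (l e : R) :
  is_lim phi m_infty l -> 0 < e -> exists A, forall x, x < A -> Rabs (phi x - l) < e.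
Proof.
  intros Hl He. apply is_lim_spec in Hl. destruct (Hl (mkposreal e He)) as [A HA].
  exists A. exact HA.
Qed.

Lemma is_lim_p_infty_bound (phi : R -> R) (l e : R) :
  is_lim phi p_infty l -> 0 < e -> exists A, forall x, A < x -> Rabs (phi x - l) < e.
Proof.
  intros Hl He. apply is_lim_spec in Hl. destruct (Hl (mkposreal e He)) as [A HA].
  exists A. exact HA.
Qed.

(** The limit 0 at -oo replaces an initial value: far to the left [phi] is below [phi b / 2], and
    the previous barrier applies to [phi - phi b / 2]. *)
Lemma barrier_m_infty (phi dphi : R -> R) (b : R) :
  is_lim phi m_infty 0 ->
  (forall x, x <= b -> continuous phi x) ->
  (forall x, x < b -> is_derive phi x (dphi x)) ->
  (forall x, x < b -> 0 < phi x -> dphi x <= 0) ->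
  phi b <= 0.
Proof.
  intros hl hc hd hb. apply Rnot_lt_le. intros Hn.
  destruct (is_lim_m_infty_bound phi 0 (phi b / 2) hl) as [A HA]; [lra|].
  set (a := Rmin (A - 1) b).
  assert (a <= A - 1) by apply Rmin_l. assert (a <= b) by apply Rmin_r.
  assert (phi a - 0 < phi b / 2).
  { apply Rle_lt_trans with (1 := Rle_abs _). apply HA. lra. }
  assert (Q := barrier (fun x => phi x - phi b / 2) dphi a b 0). simpl in Q.
  assert (phi b - phi b / 2 <= 0 * (b - a)); [|lra].
  apply Q; try lra.
  - intros x Hx. apply (continuous_minus phi (fun _ => phi b / 2)).
    + apply hc; lra.
    + apply continuous_const.
  - intros x Hx. evar_last.
    + apply (is_derive_minus phi (fun _ => phi b / 2) x (dphi x) 0).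
      * apply hd; lra.
      * apply @is_derive_const.
    + unfold minus, plus, opp; simpl. ring.
  - intros x Hx Hp. apply hb; lra.
Qed.

Lemma is_derive_continuous (phi : R -> R) x l : is_derive phi x l -> continuous phi x.
Proof.
  intros H. apply (@ex_derive_continuous R_AbsRing R_NormedModule). now exists l.
Qed.

Lemma is_derive_reflect (phi : R -> R) (a x l : R) :
  is_derive phi (a - x) l -> is_derive (fun y => phi (a - y)) x (- l).
Proof.
  intros H.
  assert (Ha : is_derive (fun y : R => a - y) x (-1)) by (auto_derive; trivial; ring).
  evar_last.
  - exact (is_derive_comp phi (fun y => a - y) x l (-1) H Ha).
  - unfold scal; simpl; unfold mult; simpl. ring.
Qed.

Lemma gronwall_zero_right (N dN : R -> R) (K x0 : R) :
  (forall x, is_derive N x (dN x)) -> (forall x, 0 <= N x) ->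
  (forall x, dN x <= K * N x) -> N x0 = 0 -> forall x, x0 <= x -> N x = 0.
Proof.
  intros hd hp hb h0 x hx.
  assert (hd' : forall y, is_derive (fun y => N y * exp (- K * y)) y
     ((dN y - K * N y) * exp (- K * y))).
  { intros y. evar_last.
    - apply (is_derive_mult N (fun y => exp (- K * y)) y (dN y) (- K * exp (- K * y))).
      + apply hd.
      + auto_derive; trivial. ring.
      + intros; apply Rmult_comm.
    - unfold plus, mult; simpl. ring. }
  assert (Q : N x * exp (- K * x) <= 0 * (x - x0)).
  { apply (barrier (fun y => N y * exp (- K * y)) (fun y => (dN y - K * N y) * exp (- K * y)) x0 x 0); try lra.
    - intros y _. eapply is_derive_continuous, hd'.
    - intros; apply hd'.
    - rewrite h0. lra.
    - intros y _ _. specialize (hb y). assert (0 < exp (- K * y)) by apply exp_pos. nra. }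
  assert (0 < exp (- K * x)) by apply exp_pos. specialize (hp x). nra.
Qed.

(** This serves as uniqueness for differential equations: [N] will be a square or a sum of squares
    vanishing at one point. [N exp(-K x)] is nonincreasing to the right of that point, and
    reflection handles the left. *)
Lemma gronwall_zero (N dN : R -> R) (K x0 : R) :
  (forall x, is_derive N x (dN x)) -> (forall x, 0 <= N x) ->
  (forall x, Rabs (dN x) <= K * N x) -> N x0 = 0 -> forall x, N x = 0.
Proof.
  intros hd hp hb h0 x. destruct (Rle_dec x0 x) as [h|h].
  - apply (gronwall_zero_right N dN K x0); auto.
    intros y. apply Rle_trans with (2 := hb y). apply Rle_abs.
  - replace x with (0 - (- x)) by ring.
    apply (gronwall_zero_right (fun y => N (0 - y)) (fun y => - dN (0 - y)) K (- x0)).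
    + intros y. apply is_derive_reflect, hd.
    + intros y. apply hp.
    + intros y. apply Rle_trans with (2 := hb (0 - y)). rewrite <- Rabs_Ropp. apply Rle_abs.
    + now replace (0 - - x0) with x0 by ring.
    + lra.
Qed.

(** Comparison with an arbitrary slope [l], for [a] and [b] in either order, covers two uses:
    [l = 0] gives Lipschitz bounds, and a small [e] gives differentiability. *)
Lemma continuous_MVT_bound (phi dphi : R -> R) (a b l e : R) :
  (forall x, Rmin a b <= x <= Rmax a b -> continuous phi x) ->
  (forall x, Rmin a b < x < Rmax a b -> is_derive phi x (dphi x)) ->
  (forall x, Rmin a b < x < Rmax a b -> Rabs (dphi x - l) <= e) ->
  Rabs (phi b - phi a - l * (b - a)) <= e * Rabs (b - a).
Proof.
  intros hc hd hb.
  destruct (Req_dec a b) as [->|hab].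
  { replace (phi b - phi b - l * (b - b)) with 0 by ring.
    replace (b - b) with 0 by ring. rewrite Rabs_R0. lra. }
  destruct (MVT_open phi dphi (Rmin a b) (Rmax a b)) as (c & Hc & E); auto.
  { unfold Rmin, Rmax; destruct (Rle_dec a b); lra. }
  assert (E' : phi b - phi a = dphi c * (b - a)).
  { unfold Rmin, Rmax in E; destruct (Rle_dec a b); lra. }
  rewrite E'. replace (dphi c * (b - a) - l * (b - a)) with ((dphi c - l) * (b - a)) by ring.
  rewrite Rabs_mult. apply Rmult_le_compat_r; [apply Rabs_pos|]. now apply hb.
Qed.

Lemma is_derive_intro (phi : R -> R) (x l : R) :
  (forall e : posreal, locally x (fun y => Rabs (phi y - phi x - l * (y - x)) <= e * Rabs (y - x))) ->
  is_derive phi x l.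
Proof.
  intros H. split.
  - apply is_linear_scal_l.
  - intros y Hy. assert (E := @is_filter_lim_locally_unique R_AbsRing R_NormedModule _ _ Hy). subst y; clear Hy.
    intros e. generalize (H e). apply filter_imp. intros y Hy.
    unfold norm, minus, plus, opp, scal; simpl; unfold abs, mult; simpl.
    replace (phi y + - phi x + - ((y + - x) * l)) with (phi y - phi x - l * (y - x)) by ring.
    exact Hy.
Qed.

Lemma locally_between (x y z : R) (d : posreal) :
  ball x d y -> Rmin x y <= z <= Rmax x y -> ball x d z.
Proof.
  unfold ball; simpl; unfold AbsRing_ball, abs, minus, plus, opp; simpl.
  intros H Hz. apply Rabs_def2 in H. apply Rabs_def1; unfold Rmin, Rmax in Hz;
  destruct (Rle_dec x y); lra.
Qed.

(** The mean value bound on either side of [a] turns continuity of [psi] into the derivative. This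
    supplies the profile equation at the point where two halves meet. *)
Lemma is_derive_punctured (phi psi : R -> R) (a : R) :
  continuous phi a -> continuous psi a ->
  locally a (fun x => x <> a -> is_derive phi x (psi x)) ->
  is_derive phi a (psi a).
Proof.
  intros hc hp [d hd]. apply is_derive_intro. intros e.
  destruct (proj1 (filterlim_locally psi (psi a)) hp e) as [d' hd'].
  exists (mkposreal _ (Rmin_stable_in_posreal d d')). intros y Hy.
  assert (Hy1 : ball a d y) by (apply ball_le with (2 := Hy); apply Rmin_l).
  assert (Hy2 : ball a d' y) by (apply ball_le with (2 := Hy); apply Rmin_r).
  assert (hne : forall x, Rmin a y < x < Rmax a y -> x <> a).
  { intros x Hx. unfold Rmin, Rmax in Hx. destruct (Rle_dec a y); lra. }
  apply (continuous_MVT_bound phi psi).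
  - intros x Hx. destruct (Req_dec x a) as [->|n]; [exact hc|].
    apply is_derive_continuous with (psi x). apply hd; auto.
    now apply locally_between with y.
  - intros x Hx. apply hd; auto. apply locally_between with y; [assumption|lra].
  - intros x Hx. left. apply (hd' x). apply locally_between with y; [assumption|lra].
Qed.

(** Convergence of the derivatives is asked jointly in the index and the point. This form composes
    with continuous operations such as division, and it lets the mean value bound pass to the
    limit. *)
Lemma is_derive_lim (phi psi : nat -> R -> R) (phil : R -> R) (a l : R) :
  (forall x, is_lim_seq (fun n => phi n x) (phil x)) ->
  filterlim (fun z : nat * R => psi (fst z) (snd z))
    (filter_prod eventually (locally a)) (locally l) ->
  (exists d : posreal, forall n x, ball a d x -> is_derive (phi n) x (psi n x)) ->
  is_derive phil a l.
Proof.
  intros hl hp [d hd]. apply is_derive_intro. intros e.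
  destruct (proj1 (filterlim_locally _ l) hp e) as [P Q [N HN] [d' HQ] HPQ].
  exists (mkposreal _ (Rmin_stable_in_posreal d d')). intros y Hy.
  assert (Hy1 : ball a d y) by (apply ball_le with (2 := Hy); apply Rmin_l).
  assert (Hy2 : ball a d' y) by (apply ball_le with (2 := Hy); apply Rmin_r).
  apply (is_lim_seq_le_loc (fun n => Rabs (phi n y - phi n a - l * (y - a)))
    (fun _ => e * Rabs (y - a)) (Rabs (phil y - phil a - l * (y - a))) (e * Rabs (y - a))).
  - exists N. intros n Hn. apply (continuous_MVT_bound (phi n) (psi n)).
    + intros x Hx. eapply is_derive_continuous. apply hd. now apply locally_between with y.
    + intros x Hx. apply hd. apply locally_between with y; [assumption|lra].
    + intros x Hx. left. apply (HPQ n x); [now apply HN|]. apply HQ.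
      apply locally_between with y; [assumption|lra].
  - apply (is_lim_seq_abs _ (Finite _)). apply is_lim_seq_minus'.
    + apply is_lim_seq_minus'; apply hl.
    + apply is_lim_seq_const.
  - apply is_lim_seq_const.
Qed.

(** * Scalar Picard theorem *)

(** A Lipschitz constant common to all [n] upgrades convergence at one point to the joint
    convergence required by [is_derive_lim]. *)
Lemma filterlim_equilipschitz (phi : nat -> R -> R) (M a l : R) :
  (forall n x y, Rabs (phi n x - phi n y) <= M * Rabs (x - y)) ->
  is_lim_seq (fun n => phi n a) l ->
  filterlim (fun z : nat * R => phi (fst z) (snd z))
    (filter_prod eventually (locally a)) (locally l).
Proof.
  intros hM hl. apply filterlim_locally. intros e.
  assert (He := cond_pos e).
  assert (HM : 0 <= Rabs M) by apply Rabs_pos.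
  assert (Hd : 0 < e / 2 / (Rabs M + 1)) by (apply Rdiv_lt_0_compat; lra).
  apply is_lim_seq_spec in hl.
  assert (He2 : 0 < e / 2) by lra.
  apply (Filter_prod _ _ _ (fun n => Rabs (phi n a - l) < e / 2)
     (fun x => ball a (mkposreal _ Hd) x)).
  - apply (hl (mkposreal _ He2)).
  - now exists (mkposreal _ Hd).
  - intros n x Hn Hx. simpl.
    unfold ball in *; simpl in *; unfold AbsRing_ball, abs, minus, plus, opp in *; simpl in *.
    replace (phi n x + - l) with ((phi n x - phi n a) + (phi n a - l)) by ring.
    apply Rle_lt_trans with (1 := Rabs_triang _ _).
    apply Rle_lt_trans with (M * Rabs (x - a) + Rabs (phi n a - l)).
    { apply Rplus_le_compat_r, hM. }
    assert (M * Rabs (x - a) <= e / 2); [|lra].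
    apply Rle_trans with ((Rabs M + 1) * Rabs (x - a)).
    { apply Rmult_le_compat_r; [apply Rabs_pos|]. assert (Q := Rle_abs M). lra. }
    apply Rle_trans with ((Rabs M + 1) * (e / 2 / (Rabs M + 1))).
    { apply Rmult_le_compat_l; [lra|]. left. exact Hx. }
    right. field. lra.
Qed.

Lemma exp_bound_right (d dd : R -> R) (A B u : R) :
  0 <= A -> d 0 = 0 -> (forall x, is_derive d x (dd x)) ->
  (forall x, 0 <= x -> dd x <= A * (B * exp (B * x))) ->
  0 <= u -> d u <= A * exp (B * u).
Proof.
  intros hA h0 hd hb hu.
  assert (hd' : forall x, is_derive (fun x => d x - A * exp (B * x)) x (dd x - A * (B * exp (B * x)))).
  { intros x. apply (is_derive_minus d (fun x => A * exp (B * x))).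
    - apply hd.
    - auto_derive; trivial. ring. }
  assert (Q : d u - A * exp (B * u) <= 0 * (u - 0)).
  { apply (barrier (fun x => d x - A * exp (B * x)) (fun x => dd x - A * (B * exp (B * x)))); try lra.
    - intros x _. eapply is_derive_continuous, hd'.
    - intros x _. apply hd'.
    - assert (0 < exp (B * 0)) by apply exp_pos. nra.
    - intros x Hx _. specialize (hb x). lra. }
  lra.
Qed.

Lemma exp_bound (d dd : R -> R) (A B u : R) :
  0 <= A -> d 0 = 0 -> (forall x, is_derive d x (dd x)) ->
  (forall x, Rabs (dd x) <= A * (B * exp (B * Rabs x))) ->
  Rabs (d u) <= A * exp (B * Rabs u).
Proof.
  intros hA h0 hd hb.
  assert (G : forall d dd : R -> R, d 0 = 0 -> (forall x, is_derive d x (dd x)) ->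
     (forall x, Rabs (dd x) <= A * (B * exp (B * Rabs x))) ->
     forall u, 0 <= u -> Rabs (d u) <= A * exp (B * u)).
  { clear d dd u h0 hd hb. intros d dd h0 hd hb u hu. apply Rabs_le. split.
    - assert (Q : - d u <= A * exp (B * u)); [|lra].
      apply (exp_bound_right (fun x => - d x) (fun x => - dd x)); auto.
      + rewrite h0. ring.
      + intros x. apply (is_derive_opp d x (dd x)), hd.
      + intros x Hx. specialize (hb x). rewrite (Rabs_right x) in hb by lra.
        apply Rle_trans with (2 := hb). rewrite <- Rabs_Ropp. apply Rle_abs.
    - apply (exp_bound_right d dd); auto.
      intros x Hx. specialize (hb x). rewrite (Rabs_right x) in hb by lra.
      apply Rle_trans with (2 := hb). apply Rle_abs. }
  destruct (Rle_dec 0 u) as [h|h].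
  - rewrite (Rabs_right u) by lra. now apply (G d dd).
  - rewrite (Rabs_left u) by lra.
    replace (d u) with (d (0 - (- u))) by (f_equal; ring).
    apply (G (fun x => d (0 - x)) (fun x => - dd (0 - x))).
    + simpl. now rewrite Rminus_0_r.
    + intros x. apply is_derive_reflect, hd.
    + intros x. rewrite Rabs_Ropp. specialize (hb (0 - x)).
      replace (Rabs (0 - x)) with (Rabs x) in hb; [exact hb|].
      rewrite <- Rabs_Ropp. f_equal; ring.
    + lra.
Qed.

Lemma derive_bound_lipschitz (phi dphi : R -> R) (M : R) :
  (forall x, is_derive phi x (dphi x)) -> (forall x, Rabs (dphi x) <= M) ->
  forall x y, Rabs (phi x - phi y) <= M * Rabs (x - y).
Proof.
  intros hd hb x y.
  replace (phi x - phi y) with (phi x - phi y - 0 * (x - y)) by ring.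
  apply (continuous_MVT_bound phi dphi).
  - intros z _. eapply is_derive_continuous, hd.
  - intros z _. apply hd.
  - intros z _. now rewrite Rminus_0_r.
Qed.

Section Picard.

Variables (F : R -> R -> R) (L M y0 : R).
Hypothesis L_pos : 0 < L.
Hypothesis F_cont : forall u y, continuous (fun z : R * R => F (fst z) (snd z)) (u, y).
Hypothesis F_lip : forall u y z, Rabs (F u y - F u z) <= L * Rabs (y - z).
Hypothesis F_bound : forall u y, Rabs (F u y) <= M.

Fixpoint picard_iter (n : nat) (u : R) : R :=
  match n with
  | O => y0
  | S n => y0 + RInt (fun s => F s (picard_iter n s)) 0 u
  end.

Lemma continuous_along (phi : R -> R) u : continuous phi u -> continuous (fun s => F s (phi s)) u.
Proof.
  intros h. apply (continuous_comp_2 (fun s => s) phi F u).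
  - apply continuous_id.
  - exact h.
  - apply F_cont.
Qed.

Lemma is_derive_picard_primitive (phi : R -> R) u :
  (forall x, continuous phi x) ->
  is_derive (fun u => y0 + RInt (fun s => F s (phi s)) 0 u) u (F u (phi u)).
Proof.
  intros hc. evar_last.
  - apply (is_derive_plus (fun _ => y0) (fun u => RInt (fun s => F s (phi s)) 0 u) u 0 (F u (phi u))).
    + apply @is_derive_const.
    + apply (is_derive_RInt (fun s => F s (phi s)) _ 0 u).
      * exists (mkposreal 1 Rlt_0_1). intros x _.
        apply (@RInt_correct R_CompleteNormedModule).
        apply (@ex_RInt_continuous R_CompleteNormedModule).
        intros z _. now apply continuous_along.
      * now apply continuous_along.
  - unfold plus; simpl. ring.
Qed.

Lemma picard_iter_continuous n u : continuous (picard_iter n) u.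
Proof.
  revert u. induction n as [|n IH]; intros u.
  - apply continuous_const.
  - eapply is_derive_continuous. apply (is_derive_picard_primitive (picard_iter n) u IH).
Qed.

Lemma is_derive_picard_iter n u : is_derive (picard_iter (S n)) u (F u (picard_iter n u)).
Proof. apply (is_derive_picard_primitive (picard_iter n) u), picard_iter_continuous. Qed.

Lemma picard_iter_0 n : picard_iter n 0 = y0.
Proof.
  destruct n as [|n]; [easy|]. simpl. rewrite RInt_point. unfold zero; simpl. ring.
Qed.

Lemma picard_iter_lipschitz n x y :
  Rabs (picard_iter n x - picard_iter n y) <= M * Rabs (x - y).
Proof.
  destruct n as [|n].
  - simpl. replace (y0 - y0) with 0 by ring. rewrite Rabs_R0.
    apply Rmult_le_pos; [|apply Rabs_pos].
    apply Rle_trans with (2 := F_bound 0 0), Rabs_pos.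
  - apply (derive_bound_lipschitz (picard_iter (S n)) (fun u => F u (picard_iter n u))).
    + intros u. apply is_derive_picard_iter.
    + intros u. apply F_bound.
Qed.

(** In the norm weighted by exp(2 L |u|), integrating an [L]-Lipschitz difference gains a factor
    1/2, so the iterates converge on the whole line at once. The factor [M / (2 * L)] comes from the
    first step, whose derivative is at most [M]. *)
Lemma picard_iter_step n u :
  Rabs (picard_iter (S n) u - picard_iter n u) <=
    M / (2 * L) * (1 / 2) ^ n * exp (2 * L * Rabs u).
Proof.
  assert (hM : 0 <= M) by (apply Rle_trans with (2 := F_bound 0 0), Rabs_pos).
  assert (hA : forall n, 0 <= M / (2 * L) * (1 / 2) ^ n).
  { intros k. apply Rmult_le_pos; [|apply pow_le; lra].
    apply Rmult_le_pos; [lra|]. left. apply Rinv_0_lt_compat. lra. }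
  revert u. induction n as [|n IH]; intros u.
  - apply (exp_bound (fun u => picard_iter 1 u - picard_iter 0 u) (fun u => F u y0) _ (2 * L)).
    + apply hA.
    + rewrite !picard_iter_0. ring.
    + intros x. evar_last.
      * apply (is_derive_minus (picard_iter 1) (picard_iter 0) x (F x y0) 0).
        -- apply is_derive_picard_iter.
        -- apply @is_derive_const.
      * exact (Rminus_0_r _).
    + intros x. apply Rle_trans with (1 := F_bound x y0).
      simpl. replace (M / (2 * L) * 1 * (2 * L * exp (2 * L * Rabs x)))
        with (M * exp (2 * L * Rabs x)) by (field; lra).
      assert (1 <= exp (2 * L * Rabs x)).
      { assert (0 <= 2 * L * Rabs x) by (apply Rmult_le_pos; [lra|apply Rabs_pos]).
        assert (Q := exp_ineq1_le (2 * L * Rabs x)). lra. }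
      nra.
  - apply (exp_bound (fun u => picard_iter (S (S n)) u - picard_iter (S n) u)
       (fun u => F u (picard_iter (S n) u) - F u (picard_iter n u)) _ (2 * L)).
    + apply hA.
    + rewrite !picard_iter_0. ring.
    + intros x. apply (is_derive_minus (picard_iter (S (S n))) (picard_iter (S n)));
        apply is_derive_picard_iter.
    + intros x. apply Rle_trans with (1 := F_lip _ _ _).
      apply Rle_trans with (1 := Rmult_le_compat_l L _ _ (Rlt_le _ _ L_pos) (IH x)).
      right. rewrite <- tech_pow_Rmult. field. lra.
Qed.

Lemma picard_iter_cv u : exists l : R, is_lim_seq (fun n => picard_iter n u) l.
Proof.
  destruct (@ex_series_le R_AbsRing R_CompleteNormedModule
     (fun n => picard_iter (S n) u - picard_iter n u)
     (fun n => M / (2 * L) * (1 / 2) ^ n * exp (2 * L * Rabs u))) as [l Hl].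
  - intros n. apply picard_iter_step.
  - apply ex_series_ext with (fun n => (M / (2 * L) * exp (2 * L * Rabs u)) * (1 / 2) ^ n).
    { intros n. simpl. ring. }
    apply (@ex_series_scal_l R_AbsRing). apply ex_series_geom. rewrite Rabs_right; lra.
  - exists (l + y0). apply is_lim_seq_incr_1.
    apply is_lim_seq_ext with (fun n => sum_n (fun n => picard_iter (S n) u - picard_iter n u) n + y0).
    + intros n. induction n as [|n IH].
      * rewrite sum_O. simpl. ring.
      * rewrite sum_Sn. unfold plus; simpl.
        simpl in IH. rewrite (Rplus_comm (sum_n _ _)), Rplus_assoc, IH. ring.
    + apply is_lim_seq_plus'; [exact Hl|apply is_lim_seq_const].
Qed.

Theorem picard : exists phi : R -> R, phi 0 = y0 /\ forall u, is_derive phi u (F u (phi u)).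
Proof.
  destruct (choice _ _ _ picard_iter_cv) as [phi Hphi].
  exists phi. split.
  - assert (E : Finite (phi 0) = Finite y0); [|now injection E].
    rewrite <- (is_lim_seq_unique _ _ (Hphi 0)).
    rewrite (Lim_seq_ext _ (fun _ => y0) picard_iter_0). apply Lim_seq_const.
  (* The derivatives of the iterates converge jointly because the iterates share the Lipschitz
     constant [M]. *)
  - intros u. apply (is_derive_lim (fun n => picard_iter (S n)) (fun n x => F x (picard_iter n x))).
    + intros x. apply (is_lim_seq_incr_1 (fun n => picard_iter n x)), Hphi.
    + apply (filterlim_comp_2 (fun z : nat * R => snd z) (fun z => picard_iter (fst z) (snd z)) F
        (G := locally u) (H := locally (phi u))).
      * apply filterlim_snd.
      * apply (filterlim_equilipschitz picard_iter M); [|apply Hphi].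
        intros; apply picard_iter_lipschitz.
      * intros P HP. destruct (F_cont u (phi u) P HP) as [d Hd].
        apply (Filter_prod _ _ _ (ball u d) (ball (phi u) d)).
        -- now exists d.
        -- now exists d.
        -- intros x y Hx Hy. apply Hd. now split.
    + exists (mkposreal 1 Rlt_0_1). intros n x _. apply is_derive_picard_iter.
Qed.

End Picard.

(** * Half profiles *)

Lemma lipschitz_continuous (phi : R -> R) (M : R) :
  (forall x y, Rabs (phi x - phi y) <= M * Rabs (x - y)) -> forall x, continuous phi x.
Proof.
  intros h x. apply filterlim_locally. intros e.
  assert (He := cond_pos e). assert (HM := Rabs_pos M).
  assert (Hd : 0 < e / (Rabs M + 1)) by (apply Rdiv_lt_0_compat; lra).
  exists (mkposreal _ Hd). intros y Hy.
  unfold ball in *; simpl in *; unfold AbsRing_ball, abs, minus, plus, opp in *; simpl in *.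
  apply Rle_lt_trans with (1 := h y x).
  apply Rle_lt_trans with ((Rabs M) * Rabs (y - x)).
  { apply Rmult_le_compat_r; [apply Rabs_pos|apply Rle_abs]. }
  apply Rle_lt_trans with (Rabs M * (e / (Rabs M + 1))).
  { apply Rmult_le_compat_l; [lra|]. left; exact Hy. }
  apply Rlt_le_trans with ((Rabs M + 1) * (e / (Rabs M + 1))).
  { apply Rmult_lt_compat_r; lra. }
  right. field. lra.
Qed.

Definition clamp (lo hi u : R) : R := Rmax lo (Rmin u hi).

Lemma clamp_in lo hi u : lo <= hi -> lo <= clamp lo hi u <= hi.
Proof. intros. unfold clamp, Rmax, Rmin. destruct (Rle_dec u hi), (Rle_dec lo _); lra. Qed.

Lemma clamp_id lo hi u : lo <= u <= hi -> clamp lo hi u = u.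
Proof. intros. unfold clamp, Rmax, Rmin. destruct (Rle_dec u hi), (Rle_dec lo _); lra. Qed.

Lemma clamp_le lo hi u : lo <= hi -> u <= lo -> clamp lo hi u = lo.
Proof. intros. unfold clamp, Rmax, Rmin. destruct (Rle_dec u hi), (Rle_dec lo _); lra. Qed.

Lemma clamp_ge lo hi u : lo <= hi -> hi <= u -> clamp lo hi u = hi.
Proof. intros. unfold clamp, Rmax, Rmin. destruct (Rle_dec u hi), (Rle_dec lo _); lra. Qed.

Lemma clamp_lipschitz lo hi x y : Rabs (clamp lo hi x - clamp lo hi y) <= Rabs (x - y).
Proof.
  unfold clamp.
  apply Rle_trans with (Rabs (Rmin x hi - Rmin y hi)).
  - generalize (Rmin x hi) (Rmin y hi). intros s t. unfold Rmax, Rabs.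
    destruct (Rle_dec lo s), (Rle_dec lo t); repeat destruct (Rcase_abs _); lra.
  - unfold Rmin, Rabs.
    destruct (Rle_dec x hi), (Rle_dec y hi); repeat destruct (Rcase_abs _); lra.
Qed.

Lemma clamp_continuous lo hi x : continuous (clamp lo hi) x.
Proof.
  apply (lipschitz_continuous _ 1). intros y z. rewrite Rmult_1_l. apply clamp_lipschitz.
Qed.

Lemma continuous_Rmax {U : UniformSpace} (phi psi : U -> R) x :
  continuous phi x -> continuous psi x -> continuous (fun y => Rmax (phi y) (psi y)) x.
Proof.
  intros h1 h2.
  apply (continuous_ext (fun y => / 2 * ((phi y + psi y) + Rabs (phi y - psi y)))).
  { intros y. unfold Rmax, Rabs. destruct (Rle_dec _ _), (Rcase_abs _); lra. }
  apply (continuous_scal_r (/ 2) (fun y => (phi y + psi y) + Rabs (phi y - psi y))).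
  apply (@continuous_plus _ R_AbsRing R_NormedModule); [now apply (@continuous_plus _ R_AbsRing R_NormedModule)|].
  apply (continuous_comp (fun y => phi y - psi y) Rabs); [|apply continuous_Rabs].
  now apply (@continuous_minus _ R_AbsRing R_NormedModule).
Qed.

Lemma filterlim_Rdiv {T : Type} {F : (T -> Prop) -> Prop} {FF : Filter F} (phi psi : T -> R) (x y : R) :
  y <> 0 -> filterlim phi F (locally x) -> filterlim psi F (locally y) ->
  filterlim (fun t => phi t / psi t) F (locally (x / y)).
Proof.
  intros hy h1 h2.
  apply (filterlim_comp_2 phi (fun t => / psi t) Rmult (G := locally x) (H := locally (/ y))).
  - exact h1.
  - apply (filterlim_comp _ _ _ psi Rinv _ (locally y)); [exact h2|]. now apply continuous_Rinv.
  - apply (@filterlim_mult R_AbsRing x (/ y)).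
Qed.

Lemma filterlim_Rplus {T : Type} {F : (T -> Prop) -> Prop} {FF : Filter F} (phi psi : T -> R) (x y : R) :
  filterlim phi F (locally x) -> filterlim psi F (locally y) ->
  filterlim (fun t => phi t + psi t) F (locally (x + y)).
Proof.
  intros h1 h2. apply (filterlim_comp_2 phi psi Rplus h1 h2).
  apply (@filterlim_plus R_AbsRing R_NormedModule x y).
Qed.

Lemma filterlim_Ropp {T : Type} {F : (T -> Prop) -> Prop} {FF : Filter F} (phi : T -> R) (x : R) :
  filterlim phi F (locally x) -> filterlim (fun t => - phi t) F (locally (- x)).
Proof.
  intros h1. apply (filterlim_comp _ _ _ phi Ropp _ _ _ h1).
  apply (@filterlim_opp R_AbsRing R_NormedModule x).
Qed.

(** The value at [a] is left free, for matching. The equation holds on the open interval because f/p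
    is singular at the ends; the bound by [- mu * f] gives positivity inside, and the Lipschitz
    bound on the whole line gives continuity at the ends. *)
Definition half_profile (f m : R -> R) (a : R) (p : R -> R) : Prop :=
  (exists K, forall x y, Rabs (p x - p y) <= K * Rabs (x - y)) /\
  p 0 = 0 /\
  (exists mu, 0 < mu /\ forall u, 0 <= u <= a -> - mu * f u <= p u) /\
  (forall u, 0 < u < a -> is_derive p u (- m u - f u / p u)).

Section HalfProfile.

Variables (f m : R -> R) (a L G : R).
Hypothesis a_pos : 0 < a.
Hypothesis m_cont : forall u, continuous m u.
Hypothesis f_ex : forall u, ex_derive f u.
Hypothesis m_bound : forall u, 0 <= u <= a -> Rabs (m u) <= G.
Hypothesis df_bound : forall u, 0 <= u <= a -> Rabs (Derive f u) <= L.
Hypothesis f_0 : f 0 = 0.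
Hypothesis f_a : f a = 0.
Hypothesis f_neg : forall u, 0 < u < a -> f u < 0.

(* With this [mu], [mu (e - f)] is a subsolution of [p' = - m + (e - f) / p] for all [e > 0]. *)
Let mu := / (1 + L + G).
Let cl := clamp 0 a.

Lemma half_L_pos : 0 <= L.
Proof. apply Rle_trans with (2 := df_bound 0 ltac:(lra)), Rabs_pos. Qed.

Lemma half_G_pos : 0 <= G.
Proof. apply Rle_trans with (2 := m_bound 0 ltac:(lra)), Rabs_pos. Qed.

Lemma half_mu_pos : 0 < mu.
Proof. assert (h1 := half_L_pos). assert (h2 := half_G_pos). apply Rinv_0_lt_compat. lra. Qed.

(** The barrier [mu * (e - f)] has slope at most [mu * L], while on it the right-hand side is at
    least [/ mu - G]; this strict gap makes it a subsolution. *)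
Lemma half_mu_small : mu * L + G < / mu.
Proof.
  assert (h1 := half_L_pos). assert (h2 := half_G_pos). assert (h3 := half_mu_pos).
  unfold mu at 2. rewrite Rinv_inv.
  assert (mu <= 1); [|nra].
  unfold mu. rewrite <- Rinv_1 at 2. apply Rinv_le_contravar; lra.
Qed.

Lemma half_f_neg0 u : 0 <= u <= a -> f u <= 0.
Proof.
  intros h. destruct (Req_dec u 0) as [->|]; [lra|]. destruct (Req_dec u a) as [->|]; [lra|].
  left. apply f_neg. lra.
Qed.

(** Replacing the denominator [y] by its maximum with the barrier makes the field bounded and
    Lipschitz without changing it above the barrier; clamping [u] extends it to the whole line. *)
Definition half_rhs (e u y : R) : R :=
  - m (cl u) + (- f (cl u) + e) / Rmax y (mu * (- f (cl u) + e)).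

Lemma half_cl_cont u : continuous cl u.
Proof. apply clamp_continuous. Qed.

Lemma half_f_cont u : continuous f u.
Proof. apply (@ex_derive_continuous R_AbsRing R_NormedModule), f_ex. Qed.

Lemma half_reg_pos e u : 0 < e -> e <= - f (cl u) + e.
Proof.
  intros he. assert (f (cl u) <= 0); [|lra]. apply half_f_neg0, clamp_in. lra.
Qed.

Lemma half_rhs_cont e u y :
  0 < e -> continuous (fun z : R * R => half_rhs e (fst z) (snd z)) (u, y).
Proof.
  intros he. unfold half_rhs.
  assert (c1 : continuous (fun z : R * R => - f (cl (fst z)) + e) (u, y)).
  { apply (@continuous_plus _ R_AbsRing R_NormedModule); [|apply continuous_const].
    apply (@continuous_opp _ R_AbsRing R_NormedModule).
    apply (continuous_comp (fun z : R * R => cl (fst z)) f); [|apply half_f_cont].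
    apply (continuous_comp fst cl); [apply continuous_fst|apply half_cl_cont]. }
  apply filterlim_Rplus.
  - apply filterlim_Ropp.
    apply (continuous_comp (fun z : R * R => cl (fst z)) m); [|apply m_cont].
    apply (continuous_comp fst cl); [apply continuous_fst|apply half_cl_cont].
  - apply filterlim_Rdiv.
    + simpl. assert (h := half_reg_pos e u he). assert (h3 := half_mu_pos).
      apply Rgt_not_eq. apply Rlt_le_trans with (2 := Rmax_r _ _). nra.
    + exact c1.
    + apply (continuous_Rmax (fun z : R * R => snd z)); [apply continuous_snd|].
      apply (continuous_scal_r mu (fun z : R * R => - f (cl (fst z)) + e)), c1.
Qed.

Lemma half_quot_bound e u y : 0 < e ->
  0 <= (- f (cl u) + e) / Rmax y (mu * (- f (cl u) + e)) <= / mu.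
Proof.
  intros he. assert (h := half_reg_pos e u he). assert (h3 := half_mu_pos).
  set (H := - f (cl u) + e) in *. set (X := Rmax y (mu * H)).
  assert (mu * H <= X) by apply Rmax_r. assert (0 < mu * H) by nra.
  split.
  - apply Rmult_le_pos; [lra|]. left. apply Rinv_0_lt_compat. lra.
  - apply Rle_div_l; [lra|]. apply Rmult_le_reg_l with mu; [lra|].
    rewrite <- Rmult_assoc, Rinv_r; lra.
Qed.

(** This bound does not depend on [e], whereas the Lipschitz constant of the field, given next,
    blows up as e -> 0. It becomes the Lipschitz constant of the limit profile. *)
Lemma half_rhs_bound e u y : 0 < e -> Rabs (half_rhs e u y) <= G + / mu.
Proof.
  intros he. unfold half_rhs. apply Rle_trans with (1 := Rabs_triang _ _).
  apply Rplus_le_compat.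
  - rewrite Rabs_Ropp. apply m_bound. apply clamp_in. lra.
  - assert (Q := half_quot_bound e u y he). rewrite Rabs_right; lra.
Qed.

Lemma half_rhs_lip e u y z : 0 < e ->
  Rabs (half_rhs e u y - half_rhs e u z) <= / (mu * mu * e) * Rabs (y - z).
Proof.
  intros he. unfold half_rhs. assert (h := half_reg_pos e u he). assert (h3 := half_mu_pos).
  set (H := - f (cl u) + e) in *.
  set (X := Rmax y (mu * H)). set (Y := Rmax z (mu * H)).
  assert (mu * H <= X) by apply Rmax_r. assert (mu * H <= Y) by apply Rmax_r.
  assert (0 < mu * H) by nra.
  assert (hme : 0 < mu * mu * e) by (apply Rmult_lt_0_compat; [apply Rmult_lt_0_compat|]; lra).
  replace (- m (cl u) + H / X - (- m (cl u) + H / Y)) with (H / (X * Y) * (Y - X)) by (field; lra).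
  rewrite Rabs_mult. apply Rmult_le_compat; try apply Rabs_pos.
  - rewrite Rabs_right.
    2:{ apply Rle_ge, Rmult_le_pos; [lra|]. left. apply Rinv_0_lt_compat. nra. }
    apply Rle_div_l; [nra|]. 
    apply Rmult_le_reg_l with (mu * mu * e); [exact hme|].
    rewrite <- Rmult_assoc, Rinv_r, Rmult_1_l by lra.
    apply Rle_trans with ((mu * H) * (mu * H)); [|apply Rmult_le_compat; lra].
    replace (mu * mu * e * H) with (mu * mu * H * e) by ring.
    replace (mu * H * (mu * H)) with (mu * mu * H * H) by ring.
    apply Rmult_le_compat_l; [|exact h]. apply Rmult_le_pos; nra.
  - unfold X, Y, Rmax, Rabs.
    destruct (Rle_dec y _), (Rle_dec z _); repeat destruct (Rcase_abs _); lra.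
Qed.

Lemma half_approx e : 0 < e -> exists p : R -> R, p 0 = mu * e /\
  (forall x y, Rabs (p x - p y) <= (G + / mu) * Rabs (x - y)) /\
  (forall u, 0 <= u <= a -> mu * (- f u + e) <= p u) /\
  (forall u, 0 < u < a -> is_derive p u (- m u + (- f u + e) / p u)).
Proof.
  intros he. assert (h3 := half_mu_pos).
  (* The starting value [mu * e] is the value of the barrier at 0. *)
  destruct (picard (half_rhs e) (/ (mu * mu * e)) (G + / mu) (mu * e)) as [p [p0 hp]].
  - apply Rinv_0_lt_compat, Rmult_lt_0_compat; [apply Rmult_lt_0_compat|]; lra.
  - intros u y. now apply half_rhs_cont.
  - intros. now apply half_rhs_lip.
  - intros. now apply half_rhs_bound.
  - assert (bar : forall u, 0 <= u <= a -> mu * (- f u + e) <= p u).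
    { intros b hb.
      set (phi := fun u => mu * (- f u + e) - p u).
      set (dphi := fun u => mu * (- Derive f u) - half_rhs e u (p u)).
      assert (hd : forall u, is_derive phi u (dphi u)).
      { intros u. apply (is_derive_minus (fun u => mu * (- f u + e)) p).
        - assert (Q := Derive_correct f u (f_ex u)). auto_derive; [apply f_ex|].
          change (Derive (fun x => f x) u) with (Derive f u). ring.
        - apply hp. }
      assert (Q : phi b <= 0 * (b - 0)).
      { apply (barrier phi dphi); try lra.
        - intros x _. eapply is_derive_continuous, hd.
        - intros x _. apply hd.
        - unfold phi. rewrite p0, f_0. lra.
        - intros x Hx Hp. unfold phi in Hp. unfold dphi, half_rhs.
          unfold cl. rewrite clamp_id by lra.
          (* Below the barrier the truncation is active and the quotient is exactly [/ mu]. *)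
          rewrite Rmax_right by lra.
          replace ((- f x + e) / (mu * (- f x + e))) with (/ mu).
          2:{ field. assert (f x < 0) by (apply f_neg; lra). lra. }
          assert (Q1 := df_bound x ltac:(lra)). assert (Q2 := m_bound x ltac:(lra)).
          apply Rabs_le_between in Q1. apply Rabs_le_between in Q2.
          assert (Q3 := half_mu_small). nra. }
      unfold phi in Q. lra. }
    exists p. split; [exact p0|]. split; [|split; [exact bar|]].
    + apply (derive_bound_lipschitz p (fun u => half_rhs e u (p u))); auto.
      intros x. now apply half_rhs_bound.
    + intros u hu. assert (E := hp u). unfold half_rhs in E.
      unfold cl in E. rewrite clamp_id in E by lra.
      rewrite Rmax_left in E; [exact E|]. apply bar. lra.
Qed.

Lemma half_profile_exists : exists p, half_profile f m a p.
Proof.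
  assert (h3 := half_mu_pos).
  set (eps := fun n : nat => / (INR n + 1)).
  assert (heps : forall n, 0 < eps n) by (intros n; apply RinvN_pos).
  assert (leps : is_lim_seq eps 0).
  { apply (is_lim_seq_inv (fun n => INR n + 1) p_infty); [|easy].
    eapply is_lim_seq_plus; [apply is_lim_seq_INR|apply is_lim_seq_const|]. reflexivity. }
  destruct (choice _ _ (fun n p => p 0 = mu * eps n /\
    (forall x y, Rabs (p x - p y) <= (G + / mu) * Rabs (x - y)) /\
    (forall u, 0 <= u <= a -> mu * (- f u + eps n) <= p u) /\
    (forall u, 0 < u < a -> is_derive p u (- m u + (- f u + eps n) / p u)))) as [p hp].
  { intros n. now apply half_approx. }
  assert (ppos : forall n u, 0 <= u <= a -> 0 < p n u).
  { intros n u hu. destruct (hp n) as (_ & _ & h & _). specialize (h u hu).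
    assert (f u <= 0) by now apply half_f_neg0. specialize (heps n). nra. }
  (* Where [p (S n)] exceeded [p n], its quotient would have a smaller numerator and a larger
     denominator, hence no larger slope; the barrier lemma then excludes the excess. *)
  assert (mono : forall n u, 0 <= u <= a -> p (S n) u <= p n u).
  { intros n b hb. destruct (hp n) as (p0 & plip & pb & pd). destruct (hp (S n)) as (q0 & qlip & qb & qd).
    assert (hn : eps (S n) <= eps n).
    { unfold eps. apply Rinv_le_contravar; [generalize (pos_INR n); lra|]. rewrite S_INR. lra. }
    set (phi := fun u => p (S n) u - p n u).
    assert (Q : phi b <= 0 * (b - 0)).
    { apply (barrier phi (fun u => (- m u + (- f u + eps (S n)) / p (S n) u) - (- m u + (- f u + eps n) / p n u))); try lra.
      - intros x _. apply (@continuous_minus _ R_AbsRing R_NormedModule).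
        + now apply (lipschitz_continuous _ (G + / mu)).
        + now apply (lipschitz_continuous _ (G + / mu)).
      - intros x hx. apply (is_derive_minus (p (S n)) (p n)); [apply qd|apply pd]; lra.
      - unfold phi. rewrite p0, q0. nra.
      - intros x hx hphi. unfold phi in hphi.
        assert (P1 := ppos n x ltac:(lra)). assert (P2 := ppos (S n) x ltac:(lra)).
        assert (F1 := f_neg x ltac:(lra)). assert (E1 := heps n). assert (E2 := heps (S n)).
        assert ((- f x + eps (S n)) / p (S n) x <= (- f x + eps n) / p n x); [|lra].
        apply Rmult_le_compat; [lra| |lra|].
        + left. now apply Rinv_0_lt_compat.
        + apply Rinv_le_contravar; lra. }
    unfold phi in Q. lra. }
  (* Evaluating through the clamp makes the limit exist, and be Lipschitz, on the whole line. *)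
  assert (cv : forall u, exists l : R, is_lim_seq (fun n => p n (cl u)) l).
  { intros u. assert (hu : 0 <= cl u <= a) by (apply clamp_in; lra).
    destruct (ex_finite_lim_seq_decr (fun n => p n (cl u)) 0) as [l hl].
    - intros n. now apply mono.
    - intros n. left. now apply ppos.
    - now exists l. }
  destruct (choice _ _ _ cv) as [q hq].
  assert (cllip : forall n x y, Rabs (p n (cl x) - p n (cl y)) <= (G + / mu) * Rabs (x - y)).
  { intros n x y. destruct (hp n) as (_ & h & _). apply Rle_trans with (1 := h _ _).
    apply Rmult_le_compat_l.
    - assert (0 < / mu) by now apply Rinv_0_lt_compat. assert (h2 := half_G_pos). lra.
    - apply clamp_lipschitz. }
  assert (qb : forall u, 0 <= u <= a -> - mu * f u <= q u).
  { intros u hu. apply (is_lim_seq_le (fun _ => - mu * f u) (fun n => p n (cl u)) (- mu * f u) (q u)).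
    - intros n. unfold cl. rewrite clamp_id by lra. destruct (hp n) as (_ & _ & h & _).
      specialize (h u hu). specialize (heps n). nra.
    - apply is_lim_seq_const.
    - apply hq. }
  exists q. split; [|split; [|split]].
  - exists (G + / mu). intros x y.
    apply (is_lim_seq_le (fun n => Rabs (p n (cl x) - p n (cl y))) (fun _ => (G + / mu) * Rabs (x - y))
      (Rabs (q x - q y)) ((G + / mu) * Rabs (x - y))).
    + intros n. apply cllip.
    + apply (is_lim_seq_abs _ (Finite _)). apply is_lim_seq_minus'; apply hq.
    + apply is_lim_seq_const.
  - assert (E : Finite (q 0) = Finite 0); [|now injection E].
    rewrite <- (is_lim_seq_unique _ _ (hq 0)). apply is_lim_seq_unique.
    apply is_lim_seq_ext with (fun n => mu * eps n).
    + intros n. unfold cl. rewrite clamp_id by lra. destruct (hp n) as (h & _). now rewrite h.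
    + replace (Finite 0) with (Rbar_mult mu 0) by (simpl; f_equal; ring).
      now apply is_lim_seq_scal_l.
  - exists mu. split; [exact h3|]. intros u hu. now apply qb.
  - intros u hu.
    apply (is_derive_lim (fun n x => p n (cl x)) (fun n x => - m x + (- f x + eps n) / p n (cl x))).
    + exact hq.
    + replace (- m u - f u / q u) with (- m u + (- f u + 0) / q u) by (unfold Rdiv; ring).
      (* The lower bound keeps the denominator positive in the limit at each interior point. *)
      assert (qu : 0 < q u).
      { apply Rlt_le_trans with (2 := qb u ltac:(lra)). assert (F1 := f_neg u hu). nra. }
      apply filterlim_Rplus.
      * apply filterlim_Ropp. apply (filterlim_comp _ _ _ snd m _ (locally u)); [apply filterlim_snd|apply m_cont].
      * apply filterlim_Rdiv; [lra| |].
        -- apply filterlim_Rplus.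
           ++ apply filterlim_Ropp.
              apply (filterlim_comp _ _ _ snd f _ (locally u)); [apply filterlim_snd|apply half_f_cont].
           ++ apply (filterlim_comp _ _ _ fst eps _ eventually); [apply filterlim_fst|exact leps].
        -- apply (filterlim_equilipschitz (fun n x => p n (cl x)) (G + / mu)); [apply cllip|apply hq].
    + assert (hd : 0 < Rmin u (a - u)) by (apply Rmin_glb_lt; lra).
      exists (mkposreal _ hd). intros n x hx.
      unfold ball in hx; simpl in hx; unfold AbsRing_ball, abs, minus, plus, opp in hx; simpl in hx.
      apply Rabs_def2 in hx.
      assert (Rmin u (a - u) <= u) by apply Rmin_l. assert (Rmin u (a - u) <= a - u) by apply Rmin_r.
      assert (hx' : 0 < x < a) by lra.
      unfold cl at 2. rewrite clamp_id by lra.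
      destruct (hp n) as (_ & _ & _ & h).
      apply (is_derive_ext_loc (p n)); [|now apply h].
      generalize (locally_interval (fun y => 0 <= y <= a) x 0 a). intros Q.
      assert (Q' : locally x (fun y => 0 <= y <= a)).
      { apply (Q (proj1 hx') (proj2 hx')). intros y; simpl; lra. }
      apply filter_imp with (2 := Q'). intros y hy. unfold cl. now rewrite clamp_id.
Qed.

End HalfProfile.

(** * Profiles on the unit interval *)

(** The bistable hypotheses are put in a form invariant under [flip], so that each one-sided
    argument at 0 transfers to 1. *)
Record nonlin (f : R -> R) (a L : R) : Prop := {
  nl_a : 0 < a < 1;
  nl_ex : forall u, ex_derive f u;
  nl_bound : forall u, 0 <= u <= 1 -> Rabs (Derive f u) <= L;
  nl_f0 : f 0 = 0;
  nl_fa : f a = 0;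
  nl_f1 : f 1 = 0;
  nl_below : forall u, u < 0 -> 0 < f u;
  nl_left : forall u, 0 < u < a -> f u < 0;
  nl_right : forall u, a < u < 1 -> 0 < f u;
  nl_above : forall u, 1 < u -> f u < 0;
  nl_d0 : Derive f 0 < 0;
  nl_d1 : Derive f 1 < 0 }.

(** If U solves the wave equation with [f] and [m], then 1 - U(-x) solves it with [flip f] and
    [flip m] and joins the same end states. The damping changes sign because x is reversed. *)
Definition flip (f : R -> R) (u : R) : R := - f (1 - u).

Lemma is_derive_flip f u l : is_derive f (1 - u) l -> is_derive (flip f) u l.
Proof.
  intros h. evar_last.
  - apply (is_derive_opp (fun y => f (1 - y)) u (- l)). now apply is_derive_reflect.
  - apply Ropp_involutive.
Qed.

Lemma nonlin_flip f a L : nonlin f a L -> nonlin (flip f) (1 - a) L.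
Proof.
  intros [ha hex hb h0 h1 h2 hbe hl hr hab hd0 hd1].
  assert (E : forall u, Derive (flip f) u = Derive f (1 - u)).
  { intros u. apply is_derive_unique, is_derive_flip, Derive_correct, hex. }
  constructor; intros; rewrite ?E; unfold flip.
  - lra.
  - exists (Derive f (1 - u)). apply is_derive_flip, Derive_correct, hex.
  - apply hb. lra.
  - rewrite Rminus_0_r. lra.
  - replace (1 - (1 - a)) with a by ring. lra.
  - replace (1 - 1) with 0 by ring. lra.
  - specialize (hab (1 - u)). lra.
  - specialize (hr (1 - u)). lra.
  - specialize (hl (1 - u)). lra.
  - specialize (hbe (1 - u)). lra.
  - now rewrite Rminus_0_r.
  - now replace (1 - 1) with 0 by ring.
Qed.

Lemma half_profile_pos f m a p u :
  (forall u, 0 < u < a -> f u < 0) -> half_profile f m a p -> 0 < u < a -> 0 < p u.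
Proof.
  intros hf (_ & _ & [mu [hmu h]] & _) hu. specialize (h u ltac:(lra)). specialize (hf u hu). nra.
Qed.

Lemma half_profile_continuous f m a p u : half_profile f m a p -> continuous p u.
Proof. intros ([K hK] & _). now apply (lipschitz_continuous p K). Qed.

(* [D = p1 - p2] solves [D' = (m2 - m1) + f D / (p1 p2)], whose last term opposes the sign of [D]. *)
Lemma half_profile_upper f m1 m2 a p1 p2 K :
  0 < a -> 0 <= K -> (forall u, 0 < u < a -> f u < 0) ->
  half_profile f m1 a p1 -> half_profile f m2 a p2 ->
  (forall u, 0 < u < a -> m2 u - m1 u <= K) -> p1 a - p2 a <= K * a.
Proof.
  intros ha hK hf h1 h2 hm.
  assert (P1 := half_profile_pos f m1 a p1). assert (P2 := half_profile_pos f m2 a p2).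
  assert (Q : p1 a - p2 a <= K * (a - 0)); [|now rewrite Rminus_0_r in Q].
  apply (barrier (fun u => p1 u - p2 u) (fun u => (- m1 u - f u / p1 u) - (- m2 u - f u / p2 u))); try lra.
  - intros x _. apply (@continuous_minus _ R_AbsRing R_NormedModule); eapply half_profile_continuous; eassumption.
  - intros x hx. destruct h1 as (_ & _ & _ & d1). destruct h2 as (_ & _ & _ & d2).
    apply (is_derive_minus p1 p2); auto.
  - destruct h1 as (_ & -> & _). destruct h2 as (_ & -> & _). lra.
  - intros x hx hp. specialize (P1 x hf h1 hx). specialize (P2 x hf h2 hx).
    specialize (hm x hx). specialize (hf x hx).
    assert (- f x / p1 x <= - f x / p2 x).
    { apply Rmult_le_compat_l; [lra|]. apply Rinv_le_contravar; lra. }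
    unfold Rdiv in *. lra.
Qed.

(** Since -f/p is positive on (0,a), p' stays above [k]. This makes the value at [a] grow at least
    linearly as s -> -oo. *)
Lemma half_profile_slope f m a p k :
  0 < a -> (forall u, 0 < u < a -> f u < 0) -> half_profile f m a p ->
  (forall u, 0 < u < a -> m u <= - k) -> k * a < p a.
Proof.
  intros ha hf h hm.
  destruct (MVT_open p (fun u => - m u - f u / p u) 0 a ha) as (c & hc & E).
  - intros x _. eapply half_profile_continuous; eassumption.
  - apply h.
  - assert (P := half_profile_pos f m a p c hf h hc). destruct h as (_ & p0 & _).
    rewrite p0 in E. specialize (hm c hc). specialize (hf c hc).
    assert (0 < - f c / p c) by (apply Rdiv_lt_0_compat; lra).
    unfold Rdiv in *. assert (k < - m c - f c * / p c) by lra. nra.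
Qed.

(** Vanishing outside [0,1] makes p a bounded Lipschitz field, so that U' = p(U) can be solved on
    the whole line. The bound by [mu * Rabs (f u)] keeps f/p bounded up to both end states and
    yields the exponential rates. *)
Record profile (f m p : R -> R) : Prop := {
  pf_lip : exists K, forall x y, Rabs (p x - p y) <= K * Rabs (x - y);
  pf_le0 : forall u, u <= 0 -> p u = 0;
  pf_ge1 : forall u, 1 <= u -> p u = 0;
  pf_lower : exists mu, 0 < mu /\ forall u, 0 <= u <= 1 -> mu * Rabs (f u) <= p u;
  pf_pos : forall u, 0 < u < 1 -> 0 < p u;
  pf_der : forall u, 0 < u < 1 -> is_derive p u (- m u - f u / p u) }.

Lemma profile_flip f m p : profile f m p -> profile (flip f) (flip m) (fun u => p (1 - u)).
Proof.
  intros [[K hK] h0 h1 [mu [hmu hl]] hp hd]. constructor.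
  - exists K. intros x y. apply Rle_trans with (1 := hK _ _).
    replace (1 - x - (1 - y)) with (- (x - y)) by ring. rewrite Rabs_Ropp. lra.
  - intros u hu. apply h1. lra.
  - intros u hu. apply h0. lra.
  - exists mu. split; [exact hmu|]. intros u hu. unfold flip. rewrite Rabs_Ropp. apply hl. lra.
  - intros u hu. apply hp. lra.
  - intros u hu. evar_last.
    + apply is_derive_reflect. apply hd. lra.
    + unfold flip, Rdiv. ring.
Qed.

Lemma locally_lt (x b : R) : x < b -> locally x (fun y => y < b).
Proof. intros h. apply (open_lt b x h). Qed.

Lemma locally_gt (x b : R) : b < x -> locally x (fun y => b < y).
Proof. intros h. apply (open_gt b x h). Qed.

Lemma Rmult_abs_le K x y : Rabs x <= Rabs y -> K * Rabs x <= Rabs K * Rabs y.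
Proof.
  intros h. apply Rle_trans with (Rabs K * Rabs x).
  - apply Rmult_le_compat_r; [apply Rabs_pos|apply Rle_abs].
  - apply Rmult_le_compat_l; [apply Rabs_pos|exact h].
Qed.

Lemma profile_glue f m a L p q :
  nonlin f a L -> (forall u, continuous m u) ->
  half_profile f m a p -> half_profile (flip f) (flip m) (1 - a) q ->
  p a = q (1 - a) -> 0 < p a -> exists P, profile f m P.
Proof.
  intros nl hm hp hq E hs. assert (nlf := nonlin_flip _ _ _ nl).
  assert (ha := nl_a _ _ _ nl).
  assert (pp := fun u => half_profile_pos f m a p u (nl_left _ _ _ nl) hp).
  assert (qp := fun u => half_profile_pos _ _ _ _ u (nl_left _ _ _ nlf) hq).
  destruct hp as ([K1 k1] & p0 & [mu1 [hmu1 b1]] & d1).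
  destruct hq as ([K2 k2] & q0 & [mu2 [hmu2 b2]] & d2).
  (* On each side of [a] one of the two terms is constantly [p a = q (1 - a)] and cancels, so the
     glued function is Lipschitz without case analysis. *)
  set (P := fun u => p (clamp 0 a u) + q (1 - clamp a 1 u) - p a).
  assert (Pl : forall u, u <= a -> P u = p (clamp 0 a u)).
  { intros u hu. unfold P. rewrite (clamp_le a 1) by lra. lra. }
  assert (Pr : forall u, a <= u -> P u = q (1 - clamp a 1 u)).
  { intros u hu. unfold P. rewrite (clamp_ge 0 a) by lra. lra. }
  assert (Plip : forall x y, Rabs (P x - P y) <= (Rabs K1 + Rabs K2) * Rabs (x - y)).
  { intros x y. unfold P.
    replace (p (clamp 0 a x) + q (1 - clamp a 1 x) - p a - (p (clamp 0 a y) + q (1 - clamp a 1 y) - p a))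
      with ((p (clamp 0 a x) - p (clamp 0 a y)) + (q (1 - clamp a 1 x) - q (1 - clamp a 1 y))) by ring.
    apply Rle_trans with (1 := Rabs_triang _ _). rewrite Rmult_plus_distr_r.
    apply Rplus_le_compat.
    - apply Rle_trans with (1 := k1 _ _). apply Rmult_abs_le, clamp_lipschitz.
    - apply Rle_trans with (1 := k2 _ _).
      replace (1 - clamp a 1 x - (1 - clamp a 1 y)) with (- (clamp a 1 x - clamp a 1 y)) by ring.
      rewrite Rabs_Ropp. apply Rmult_abs_le, clamp_lipschitz. }
  assert (Ppos : forall u, 0 < u < 1 -> 0 < P u).
  { intros u hu. destruct (Rtotal_order u a) as [h|[->|h]].
    - rewrite Pl, clamp_id by lra. apply pp. lra.
    - rewrite Pl, clamp_id by lra. exact hs.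
    - rewrite Pr, clamp_id by lra. apply qp. lra. }
  assert (Pder : forall u, 0 < u < 1 -> u <> a -> is_derive P u (- m u - f u / P u)).
  { intros u hu hne. destruct (Rtotal_order u a) as [h|[h|h]]; [|lra|].
    - rewrite Pl, clamp_id by lra. apply (is_derive_ext_loc p); [|apply d1; lra].
      apply filter_imp with (fun y => 0 < y /\ y < a).
      + intros y hy. rewrite Pl, clamp_id by lra. reflexivity.
      + apply filter_and; [apply locally_gt|apply locally_lt]; lra.
    - rewrite Pr, clamp_id by lra. apply (is_derive_ext_loc (fun u => q (1 - u))).
      + apply filter_imp with (fun y => a < y /\ y < 1).
        * intros y hy. rewrite Pr, clamp_id by lra. reflexivity.
        * apply filter_and; [apply locally_gt|apply locally_lt]; lra.
      + evar_last.
        * apply is_derive_reflect. apply d2. lra.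
        * unfold flip. replace (1 - (1 - u)) with u by ring. unfold Rdiv. ring. }
  exists P. constructor.
  - now exists (Rabs K1 + Rabs K2).
  - intros u hu. rewrite Pl, clamp_le by lra. exact p0.
  - intros u hu. rewrite Pr, clamp_ge by lra. now replace (1 - 1) with 0 by ring.
  - exists (Rmin mu1 mu2). split; [now apply Rmin_glb_lt|]. intros u hu.
    destruct (Rle_dec u a) as [h|h].
    + rewrite Pl, clamp_id by lra. apply Rle_trans with (2 := b1 u ltac:(lra)).
      assert (f u <= 0) by (apply (half_f_neg0 f a); [lra|apply nl|apply nl|apply nl|lra]).
      rewrite Rabs_left1 by lra. assert (Rmin mu1 mu2 <= mu1) by apply Rmin_l. nra.
    + rewrite Pr, clamp_id by lra. apply Rle_trans with (2 := b2 (1 - u) ltac:(lra)).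
      assert (Q : flip f (1 - u) <= 0) by (apply (half_f_neg0 (flip f) (1 - a)); [lra|apply nlf|apply nlf|apply nlf|lra]).
      unfold flip in *. replace (1 - (1 - u)) with u in * by ring.
      rewrite Rabs_right by lra. assert (Rmin mu1 mu2 <= mu2) by apply Rmin_r. nra.
  - exact Ppos.
  - intros u hu. destruct (Req_dec u a) as [->|hne]; [|now apply Pder].
    (* At [a] the equation holds by continuity of its right-hand side, since [P a] is positive. *)
    apply (is_derive_punctured P (fun u => - m u - f u / P u)).
    + now apply (lipschitz_continuous P (Rabs K1 + Rabs K2)).
    + apply filterlim_Rplus.
      * apply filterlim_Ropp, hm.
      * apply filterlim_Ropp, filterlim_Rdiv.
        -- specialize (Ppos a hu). lra.
        -- apply (@ex_derive_continuous R_AbsRing R_NormedModule), nl.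
        -- now apply (lipschitz_continuous P (Rabs K1 + Rabs K2)).
    + apply filter_imp with (fun y => 0 < y /\ y < 1).
      * intros y hy hya. now apply Pder.
      * apply filter_and; [apply locally_gt|apply locally_lt]; lra.
Qed.

(** Half profiles are chosen arbitrarily, one for each [s]; the comparison applies to any choice and
    makes the value at [a] nonincreasing and Lipschitz in [s]. *)
Lemma half_family (f : R -> R) a L (g : R -> R) g0 G :
  nonlin f a L -> (forall u, continuous g u) -> 0 < g0 ->
  (forall u, 0 <= u <= 1 -> g0 <= g u <= G) ->
  exists P : R -> R -> R,
    (forall s, half_profile f (fun u => s * g u) a (P s)) /\
    (forall s, 0 <= P s a) /\
    (forall s, s <= 0 -> - s * g0 * a < P s a) /\
    (forall s t, s <= t -> 0 <= P s a - P t a <= (t - s) * G * a).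
Proof.
  intros nl hg hg0 hgb. assert (ha := nl_a _ _ _ nl).
  assert (hG : 0 < G) by (specialize (hgb 0); lra).
  destruct (choice _ _ (fun s p => half_profile f (fun u => s * g u) a p)) as [P hP].
  { intros s. apply (half_profile_exists f _ a L (Rabs s * G)); try apply nl.
    - intros u. apply (continuous_scal_r s g), hg.
    - intros u hu. rewrite Rabs_mult. apply Rmult_le_compat_l; [apply Rabs_pos|].
      specialize (hgb u). rewrite Rabs_right; lra.
    - intros u hu. apply nl. lra. }
  exists P. split; [exact hP|]. split; [|split].
  - intros s. destruct (hP s) as (_ & _ & [mu [hmu h]] & _). specialize (h a).
    rewrite (nl_fa _ _ _ nl) in h. lra.
  - intros s hs. apply (half_profile_slope f (fun u => s * g u)); auto; [lra|apply nl|].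
    intros u hu. specialize (hgb u). nra.
  - intros s t hst. split.
    + assert (Q : P t a - P s a <= 0 * a); [|lra].
      apply (half_profile_upper f (fun u => t * g u) (fun u => s * g u)); auto; try lra; [apply nl|].
      intros u hu. specialize (hgb u). nra.
    + apply (half_profile_upper f (fun u => s * g u) (fun u => t * g u)); auto; try lra.
      * apply Rmult_le_pos; lra.
      * apply nl.
      * intros u hu. specialize (hgb u). nra.
Qed.

Theorem profile_exists (f : R -> R) a L (g : R -> R) g0 G :
  nonlin f a L -> (forall u, continuous g u) -> 0 < g0 ->
  (forall u, 0 <= u <= 1 -> g0 <= g u <= G) ->
  exists s p, profile f (fun u => s * g u) p.
Proof.
  intros nl hg hg0 hgb. assert (ha := nl_a _ _ _ nl).
  assert (hG : 0 < G) by (specialize (hgb 0); lra).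
  assert (nlf := nonlin_flip _ _ _ nl).
  destruct (half_family f a L g g0 G nl hg hg0 hgb) as (P & hP & P0 & Ps & Pm).
  (* Reflection turns the damping [s * g u] into [(- s) * g (1 - u)], so the right half for [s] is
     [Q (- s)]. *)
  destruct (half_family (flip f) (1 - a) L (fun u => g (1 - u)) g0 G nlf) as (Q & hQ & Q0 & Qs & Qm).
  { intros u. apply (continuous_comp (fun u => 1 - u) g); [|apply hg].
    apply (@ex_derive_continuous R_AbsRing R_NormedModule). auto_derive. trivial. }
  { exact hg0. }
  { intros u hu. apply hgb. lra. }
  set (H := fun s => P s a - Q (- s) (1 - a)).
  (* The Lipschitz constants [G * a] and [G * (1 - a)] of the two halves add up to [G]. *)
  assert (mono : forall s t, s <= t -> 0 <= H s - H t <= G * (t - s)).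
  { intros s t hst. specialize (Pm s t hst). specialize (Qm (- t) (- s) ltac:(lra)).
    unfold H. nra. }
  assert (Hc : continuity H).
  { intros s. apply continuity_pt_filterlim. apply (lipschitz_continuous H G).
    intros x y. destruct (Rle_dec x y) as [h|h].
    - specialize (mono x y h). rewrite (Rabs_left1 (x - y)), Rabs_right; lra.
    - specialize (mono y x ltac:(lra)). rewrite (Rabs_right (x - y)), Rabs_left1; lra. }
  (* At s = -A the left value exceeds [A * g0 * a], and at s = A the right value exceeds
     [A * g0 * (1 - a)]. [A] is chosen so that these dominate the opposite values at s = 0, which by
     monotonicity dominate the opposite values at -A and A. *)
  set (A := Q 0 (1 - a) / (g0 * a) + P 0 a / (g0 * (1 - a))).
  assert (d1 : 0 < g0 * a) by (apply Rmult_lt_0_compat; lra).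
  assert (d2 : 0 < g0 * (1 - a)) by (apply Rmult_lt_0_compat; lra).
  assert (A1 : 0 <= Q 0 (1 - a) / (g0 * a)).
  { apply Rmult_le_pos; [apply Q0|]. left. now apply Rinv_0_lt_compat. }
  assert (A2 : 0 <= P 0 a / (g0 * (1 - a))).
  { apply Rmult_le_pos; [apply P0|]. left. now apply Rinv_0_lt_compat. }
  assert (A3 : Q 0 (1 - a) <= A * (g0 * a)).
  { apply Rle_trans with (Q 0 (1 - a) / (g0 * a) * (g0 * a)).
    - right. field. lra.
    - apply Rmult_le_compat_r; unfold A; lra. }
  assert (A4 : P 0 a <= A * (g0 * (1 - a))).
  { apply Rle_trans with (P 0 a / (g0 * (1 - a)) * (g0 * (1 - a))).
    - right. field. lra.
    - apply Rmult_le_compat_r; unfold A; lra. }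
  assert (A0 : 0 <= A) by (unfold A; lra).
  assert (H1 : 0 <= H (- A)).
  { unfold H. rewrite Ropp_involutive. specialize (Ps (- A) ltac:(lra)).
    specialize (Qm 0 A A0). lra. }
  assert (H2 : H A <= 0).
  { unfold H. specialize (Qs (- A) ltac:(lra)). specialize (Pm 0 A A0). lra. }
  destruct (IVT_cor H (- A) A Hc) as [s [_ Hs]]; [lra|nra|].
  unfold H in Hs. exists s.
  apply (profile_glue f (fun u => s * g u) a L (P s) (Q (- s))); auto.
  - intros u. apply (continuous_scal_r s g), hg.
  - specialize (hQ (- s)). destruct hQ as (q1 & q2 & q3 & q4).
    split; [exact q1|]. split; [exact q2|]. split; [exact q3|].
    intros u hu. evar_last; [exact (q4 u hu)|]. unfold flip. ring.
  - lra.
  (* The common value is positive: the strict slope bound applies to the left half if s <= 0 and to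
     the right half otherwise. *)
  - destruct (Rle_dec s 0) as [h|h].
    + specialize (Ps s h). assert (0 <= - s * g0 * a); [|lra].
      apply Rmult_le_pos; [apply Rmult_le_pos|]; lra.
    + specialize (Qs (- s) ltac:(lra)). assert (0 <= - - s * g0 * (1 - a)); [|lra].
      apply Rmult_le_pos; [apply Rmult_le_pos|]; lra.
Qed.

(** * Waves and their comparison with profiles *)

Lemma is_derive_pos_local (phi : R -> R) x l :
  is_derive phi x l -> 0 < l -> exists d, 0 < d /\
    (forall y, x - d < y < x -> phi y < phi x) /\ (forall y, x < y < x + d -> phi x < phi y).
Proof.
  intros [_ h] hl. specialize (h x (fun P HP => HP)).
  assert (he : 0 < l / 2) by lra.
  destruct (h (mkposreal _ he)) as [d hd].
  assert (Hd := cond_pos d).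
  assert (Q : forall y, Rabs (y - x) < d -> Rabs (phi y - phi x - l * (y - x)) <= l / 2 * Rabs (y - x)).
  { intros y hy. specialize (hd y hy).
    unfold norm, minus, plus, opp, scal in hd; simpl in hd; unfold abs, mult in hd; simpl in hd.
    replace (phi y - phi x - l * (y - x)) with (phi y + - phi x + - ((y + - x) * l)) by ring.
    exact hd. }
  exists d. split; [exact Hd|]. split; intros y hy.
  - assert (E : Rabs (y - x) = x - y) by (rewrite Rabs_left; lra).
    specialize (Q y). rewrite E in Q. specialize (Q ltac:(lra)). apply Rabs_le_between in Q. nra.
  - assert (E : Rabs (y - x) = y - x) by (rewrite Rabs_right; lra).
    specialize (Q y). rewrite E in Q. specialize (Q ltac:(lra)). apply Rabs_le_between in Q. nra.
Qed.

Lemma is_lim_m_infty_intro (phi : R -> R) (l : R) :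
  (forall e, 0 < e -> exists A, forall x, x < A -> Rabs (phi x - l) < e) -> is_lim phi m_infty l.
Proof. intros h. apply is_lim_spec. intros e. apply (h e (cond_pos e)). Qed.

Lemma is_lim_p_infty_intro (phi : R -> R) (l : R) :
  (forall e, 0 < e -> exists A, forall x, A < x -> Rabs (phi x - l) < e) -> is_lim phi p_infty l.
Proof. intros h. apply is_lim_spec. intros e. apply (h e (cond_pos e)). Qed.

Lemma is_lim_reflect_p (phi : R -> R) (l : R) :
  is_lim phi m_infty l -> is_lim (fun x => phi (0 - x)) p_infty l.
Proof.
  intros h. apply is_lim_p_infty_intro. intros e he.
  destruct (is_lim_m_infty_bound phi l e h he) as [A hA].
  exists (- A). intros x hx. apply hA. lra.
Qed.

Lemma is_lim_reflect_m (phi : R -> R) (l : R) :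
  is_lim phi p_infty l -> is_lim (fun x => phi (0 - x)) m_infty l.
Proof.
  intros h. apply is_lim_m_infty_intro. intros e he.
  destruct (is_lim_p_infty_bound phi l e h he) as [A hA].
  exists (- A). intros x hx. apply hA. lra.
Qed.

Lemma is_lim_1_minus (phi : R -> R) x (l : R) :
  is_lim phi x l -> is_lim (fun y => 1 - phi y) x (1 - l).
Proof. intros h. apply (is_lim_minus' (fun _ => 1)); [apply is_lim_const|exact h]. Qed.

Record wave (f m U W : R -> R) : Prop := {
  wv_U : forall x, is_derive U x (W x);
  wv_W : forall x, is_derive W x (- m (U x) * W x - f (U x));
  wv_U0 : is_lim U m_infty 0;
  wv_U1 : is_lim U p_infty 1;
  wv_W0 : is_lim W m_infty 0;
  wv_W1 : is_lim W p_infty 0 }.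

Definition rev1 (U : R -> R) (x : R) : R := 1 - U (0 - x).

Lemma is_derive_rev1 (U : R -> R) x l : is_derive U (0 - x) l -> is_derive (rev1 U) x l.
Proof.
  intros h. evar_last.
  - apply (is_derive_minus (fun _ => 1) (fun x => U (0 - x)) x 0 (- l)).
    + apply @is_derive_const.
    + now apply is_derive_reflect.
  - unfold minus, plus, opp; simpl. ring.
Qed.

Lemma is_lim_rev1_p (U : R -> R) (l : R) : is_lim U m_infty l -> is_lim (rev1 U) p_infty (1 - l).
Proof. intros h. apply (is_lim_1_minus (fun x => U (0 - x))). now apply is_lim_reflect_p. Qed.

Lemma is_lim_rev1_m (U : R -> R) (l : R) : is_lim U p_infty l -> is_lim (rev1 U) m_infty (1 - l).
Proof. intros h. apply (is_lim_1_minus (fun x => U (0 - x))). now apply is_lim_reflect_m. Qed.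

Lemma wave_flip f m U W :
  wave f m U W -> wave (flip f) (flip m) (rev1 U) (fun x => W (0 - x)).
Proof.
  intros [dU dW u0 u1 w0 w1]. constructor.
  - intros x. apply is_derive_rev1, dU.
  - intros x. evar_last; [apply is_derive_reflect, dW|].
    unfold flip, rev1. replace (1 - (1 - U (0 - x))) with (U (0 - x)) by ring. ring.
  - replace 0 with (1 - 1) by ring. now apply is_lim_rev1_m.
  - replace (Finite 1) with (Finite (1 - 0)) by (f_equal; ring). now apply is_lim_rev1_p.
  - now apply is_lim_reflect_m.
  - now apply is_lim_reflect_p.
Qed.

Lemma nonlin_lipschitz f a L u v : nonlin f a L -> 0 <= u <= 1 -> 0 <= v <= 1 ->
  Rabs (f u - f v) <= L * Rabs (u - v).
Proof.
  intros nl hu hv.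
  replace (f u - f v) with (f u - f v - 0 * (u - v)) by ring.
  assert (Hm : forall x, Rmin v u <= x <= Rmax v u -> 0 <= x <= 1).
  { intros x. unfold Rmin, Rmax. destruct (Rle_dec v u); lra. }
  apply (continuous_MVT_bound f (Derive f)).
  - intros x _. apply (@ex_derive_continuous R_AbsRing R_NormedModule), nl.
  - intros x _. apply Derive_correct, nl.
  - intros x hx. rewrite Rminus_0_r. apply nl, Hm. lra.
Qed.

Lemma nonlin_bound0 f a L u : nonlin f a L -> 0 <= u <= 1 -> Rabs (f u) <= L * u.
Proof.
  intros nl hu. assert (Q := nonlin_lipschitz f a L u 0 nl hu ltac:(lra)).
  rewrite (nl_f0 _ _ _ nl), !Rminus_0_r in Q. now rewrite (Rabs_right u) in Q by lra.
Qed.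

Lemma nonlin_bound1 f a L u : nonlin f a L -> 0 <= u <= 1 -> Rabs (f u) <= L * (1 - u).
Proof.
  intros nl hu. assert (Q := nonlin_lipschitz f a L u 1 nl hu ltac:(lra)).
  rewrite (nl_f1 _ _ _ nl), Rminus_0_r, Rabs_minus_sym in Q. now rewrite (Rabs_right (1 - u)) in Q by lra.
Qed.

(** Otherwise U has a negative interior minimum. There U' = 0 and U'' = -f(U) < 0, contrary to
    minimality. *)
Lemma wave_nonneg f a L m U W : nonlin f a L -> wave f m U W -> forall x, 0 <= U x.
Proof.
  intros nl wv x. apply Rnot_lt_le. intros hx.
  destruct (is_lim_m_infty_bound U 0 (- U x) (wv_U0 _ _ _ _ wv)) as [A hA]; [lra|].
  destruct (is_lim_p_infty_bound U 1 1 (wv_U1 _ _ _ _ wv)) as [B hB]; [lra|].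
  set (s := Rmin (A - 1) x). set (t := Rmax (B + 1) x).
  assert (s <= A - 1) by apply Rmin_l. assert (s <= x) by apply Rmin_r.
  assert (B + 1 <= t) by apply Rmax_l. assert (x <= t) by apply Rmax_r.
  assert (hs : U x < U s) by (specialize (hA s ltac:(lra)); apply Rabs_def2 in hA; lra).
  assert (ht : U x < U t) by (specialize (hB t ltac:(lra)); apply Rabs_def2 in hB; lra).
  destruct (continuity_ab_min U s t) as (z & hz & hzi); [lra| |].
  { intros c _. apply continuity_pt_filterlim. eapply is_derive_continuous, wv. }
  assert (hzx : U z <= U x) by (apply hz; lra).
  assert (s < z).
  { destruct (Rle_lt_or_eq_dec _ _ (proj1 hzi)) as [|e]; [easy|]. rewrite e in hs; lra. }
  assert (z < t).
  { destruct (Rle_lt_or_eq_dec _ _ (proj2 hzi)) as [|e]; [easy|]. rewrite <- e in ht; lra. }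
  assert (no_less : forall y, s < y < t -> ~ U y < U z).
  { intros y hy hlt. specialize (hz y ltac:(lra)). lra. }
  assert (right_neg : forall d, 0 < d -> exists y, z < y < z + d /\ s < y < t).
  { intros d hd. exists (z + Rmin d (t - z) / 2).
    assert (Rmin d (t - z) <= d) by apply Rmin_l. assert (Rmin d (t - z) <= t - z) by apply Rmin_r.
    assert (0 < Rmin d (t - z)) by (apply Rmin_glb_lt; lra). lra. }
  destruct (Rtotal_order (W z) 0) as [h|[h|h]].
  - destruct (is_derive_pos_local (fun y => - U y) z (- W z)) as (d & hd & _ & hr).
    { apply (is_derive_opp U z (W z)), wv. } { lra. }
    destruct (right_neg d hd) as (y & hy1 & hy2). apply (no_less y hy2). specialize (hr y hy1). lra.
  - assert (dW := wv_W _ _ _ _ wv z). assert (fz := nl_below _ _ _ nl (U z) ltac:(lra)).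
    destruct (is_derive_pos_local (fun y => - W y) z (f (U z))) as (d & hd & _ & hr); [|exact fz|].
    { evar_last; [apply (is_derive_opp W z _ dW)|]. unfold opp; simpl. rewrite h. ring. }
    destruct (right_neg d hd) as (y & hy1 & hy2).
    destruct (MVT_open U W z y) as (c & hc & E); [lra| | |].
    { intros c _. eapply is_derive_continuous, wv. } { intros c _. apply wv. }
    apply (no_less y hy2). specialize (hr c ltac:(lra)). nra.
  - destruct (is_derive_pos_local U z (W z)) as (d & hd & hl & _); [apply wv|exact h|].
    set (y := z - Rmin d (z - s) / 2).
    assert (Rmin d (z - s) <= d) by apply Rmin_l. assert (Rmin d (z - s) <= z - s) by apply Rmin_r.
    assert (0 < Rmin d (z - s)) by (apply Rmin_glb_lt; lra).
    apply (no_less y); [unfold y; lra|]. apply hl. unfold y; lra.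
Qed.

Lemma wave_in01 f a L m U W : nonlin f a L -> wave f m U W -> forall x, 0 <= U x <= 1.
Proof.
  intros nl wv x. split; [now apply (wave_nonneg f a L m U W)|].
  assert (Q := wave_nonneg _ _ _ _ _ _ (nonlin_flip _ _ _ nl) (wave_flip _ _ _ _ wv) (- x)).
  unfold rev1 in Q. replace (0 - - x) with x in Q by ring. lra.
Qed.

(** If U touches 0 it has a minimum there, so W vanishes as well; (0,0) is an equilibrium, and
    Gronwall's inequality for U^2 + W^2 makes U vanish identically, contrary to its limit 1. *)
Lemma wave_pos f a L m U W G : nonlin f a L -> wave f m U W ->
  (forall u, 0 <= u <= 1 -> Rabs (m u) <= G) -> forall x, 0 < U x.
Proof.
  intros nl wv hm x. assert (hU := wave_in01 f a L m U W nl wv).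
  destruct (Rle_lt_or_eq_dec _ _ (proj1 (hU x))) as [|E]; [easy|]. exfalso. symmetry in E.
  assert (hW : W x = 0).
  { destruct (Rtotal_order (W x) 0) as [h|[h|h]]; [|exact h|].
    - destruct (is_derive_pos_local (fun y => - U y) x (- W x)) as (d & hd & _ & hr).
      { apply (is_derive_opp U x (W x)), wv. } { lra. }
      specialize (hr (x + d / 2) ltac:(lra)). specialize (hU (x + d / 2)). lra.
    - destruct (is_derive_pos_local U x (W x)) as (d & hd & hl & _); [apply wv|exact h|].
      specialize (hl (x - d / 2) ltac:(lra)). specialize (hU (x - d / 2)). lra. }
  assert (hN : forall y, U y * U y + W y * W y = 0).
  { apply (gronwall_zero _ (fun y => 2 * U y * W y + 2 * W y * (- m (U y) * W y - f (U y))) (1 + L + 2 * G) x).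
    - intros y. assert (dU := wv_U _ _ _ _ wv y). assert (dW := wv_W _ _ _ _ wv y).
      evar_last.
      + apply (is_derive_plus (fun y => U y * U y) (fun y => W y * W y)).
        * apply (is_derive_mult U U y _ _ dU dU). intros; apply Rmult_comm.
        * apply (is_derive_mult W W y _ _ dW dW). intros; apply Rmult_comm.
      + unfold plus, mult; simpl. ring.
    - intros y. nra.
    - intros y. specialize (hm (U y) (hU y)). specialize (hU y).
      assert (Q := nonlin_bound0 f a L (U y) nl hU).
      apply Rabs_le_between in hm. apply Rabs_le_between in Q.
      assert (hL : 0 <= L) by (apply Rle_trans with (2 := nl_bound _ _ _ nl 0 ltac:(lra)), Rabs_pos).
      set (u := U y) in *. set (w := W y) in *. clearbody u w.
      assert (E1 : - (L * (u * u + w * w)) <= 2 * w * f u <= L * (u * u + w * w)).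
      { split.
        - destruct (Rle_dec 0 w).
          + apply Rle_trans with (2 * w * - (L * u)); [|apply Rmult_le_compat_l; lra].
            assert (Q0 := Rmult_le_pos _ _ hL (Rle_0_sqr (u - w))). unfold Rsqr in Q0. lra.
          + apply Rle_trans with (- (2 * - w * (L * u))).
            2:{ replace (2 * w * f u) with (- (2 * - w * f u)) by ring.
                apply Ropp_le_contravar, Rmult_le_compat_l; lra. }
            assert (Q0 := Rmult_le_pos _ _ hL (Rle_0_sqr (u + w))). unfold Rsqr in Q0. lra.
        - destruct (Rle_dec 0 w).
          + apply Rle_trans with (2 * w * (L * u)); [apply Rmult_le_compat_l; lra|].
            assert (Q0 := Rmult_le_pos _ _ hL (Rle_0_sqr (u - w))). unfold Rsqr in Q0. lra.
          + apply Rle_trans with (2 * - w * (L * u)).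
            { replace (2 * w * f u) with (2 * - w * - f u) by ring.
              apply Rmult_le_compat_l; lra. }
            assert (Q0 := Rmult_le_pos _ _ hL (Rle_0_sqr (u + w))). unfold Rsqr in Q0. lra. }
      assert (E2 : - (G * (w * w)) <= m u * (w * w) <= G * (w * w)).
      { assert (hw := Rle_0_sqr w). unfold Rsqr in hw. split; nra. }
      assert (E3 : - (u * u + w * w) <= 2 * u * w <= u * u + w * w) by (assert (q1 := Rle_0_sqr (u - w)); assert (q2 := Rle_0_sqr (u + w)); unfold Rsqr in *; split; lra).
      assert (0 <= G * (u * u)) by (apply Rmult_le_pos; [lra|apply (Rle_0_sqr u)]).
      apply Rabs_le. split; lra.
    - rewrite E, hW. ring. }
  destruct (is_lim_p_infty_bound U 1 1 (wv_U1 _ _ _ _ wv)) as [B hB]; [lra|].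
  specialize (hB (B + 1) ltac:(lra)). apply Rabs_def2 in hB.
  specialize (hN (B + 1)). nra.
Qed.

Lemma flip_bound m G : (forall u, 0 <= u <= 1 -> Rabs (m u) <= G) ->
  forall u, 0 <= u <= 1 -> Rabs (flip m u) <= G.
Proof. intros h u hu. unfold flip. rewrite Rabs_Ropp. apply h. lra. Qed.

Lemma wave_strict01 f a L m U W G : nonlin f a L -> wave f m U W ->
  (forall u, 0 <= u <= 1 -> Rabs (m u) <= G) -> forall x, 0 < U x < 1.
Proof.
  intros nl wv hm x. split; [now apply (wave_pos f a L m U W G)|].
  assert (Q := wave_pos _ _ _ _ _ _ G (nonlin_flip _ _ _ nl) (wave_flip _ _ _ _ wv) (flip_bound m G hm) (- x)).
  unfold rev1 in Q. replace (0 - - x) with x in Q by ring. lra.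
Qed.

Lemma wave_first_hit f m a U W : wave f m U W -> 0 < a < 1 ->
  exists x0, U x0 = a /\ forall x, x < x0 -> U x < a.
Proof.
  intros wv ha.
  destruct (is_lim_m_infty_bound U 0 a (wv_U0 _ _ _ _ wv)) as [A hA]; [lra|].
  destruct (is_lim_p_infty_bound U 1 (1 - a) (wv_U1 _ _ _ _ wv)) as [B hB]; [lra|].
  assert (hA' : forall x, x < A -> U x < a).
  { intros x hx. specialize (hA x hx). apply Rabs_def2 in hA. lra. }
  set (b := Rmax A (B + 1)). assert (A <= b) by apply Rmax_l. assert (B + 1 <= b) by apply Rmax_r.
  destruct (first_zero (fun x => a - U x) (A - 1) b) as (c & hc & E & P).
  - lra.
  - intros x _. apply (continuous_minus (fun _ => a) U); [apply continuous_const|].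
    eapply is_derive_continuous, wv.
  - specialize (hA' (A - 1)). lra.
  - specialize (hB b ltac:(lra)). apply Rabs_def2 in hB. lra.
  - exists c. split; [lra|]. intros x hx. destruct (Rlt_dec x (A - 1)) as [h|h].
    + apply hA'. lra.
    + specialize (P x). lra.
Qed.

(** Where W vanishes, W' = -f(U) > 0, so W cannot pass from positive to nonpositive. If W were
    nonpositive at [x], it would be so on the whole half line to the left, and U >= U x > 0 there
    would contradict the limit 0. *)
Lemma wave_increasing_left f a L m U W x0 : nonlin f a L -> wave f m U W ->
  (forall x, x < x0 -> 0 < U x < a) -> forall x, x < x0 -> 0 < W x.
Proof.
  intros nl wv hU x hx. apply Rnot_le_lt. intros hW.
  assert (neg : forall z, z < x -> W z <= 0).
  { intros z hz. apply Rnot_lt_le. intros hWz.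
    destruct (first_zero W z x) as (c & hc & E & P); [lra| |exact hWz|exact hW|].
    { intros y _. eapply is_derive_continuous, wv. }
    destruct (is_derive_pos_local W c (- f (U c))) as (d & hd & hl & _).
    - evar_last; [apply (wv_W _ _ _ _ wv)|]. rewrite E. simpl. ring.
    - assert (f (U c) < 0); [|lra]. apply nl, hU. lra.
    - set (y := Rmax z (c - d / 2)). assert (z <= y) by apply Rmax_l. assert (c - d / 2 <= y) by apply Rmax_r.
      assert (y < c) by (apply Rmax_lub_lt; lra).
      specialize (P y ltac:(lra)). specialize (hl y ltac:(lra)). lra. }
  destruct (is_lim_m_infty_bound U 0 (U x) (wv_U0 _ _ _ _ wv)) as [A hA]; [apply hU; lra|].
  set (z := Rmin (A - 1) (x - 1)). assert (z <= A - 1) by apply Rmin_l. assert (z <= x - 1) by apply Rmin_r.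
  specialize (hA z ltac:(lra)). apply Rabs_def2 in hA.
  destruct (MVT_open U W z x) as (c & hc & E); [lra| | |].
  { intros c _. eapply is_derive_continuous, wv. } { intros c _. apply wv. }
  specialize (neg c ltac:(lra)). nra.
Qed.

Lemma profile_continuous f m p u : profile f m p -> continuous p u.
Proof. intros pf. destruct (pf_lip _ _ _ pf) as [K hK]. now apply (lipschitz_continuous p K). Qed.

(** * Comparison of a wave with a profile along its own orbit *)

Section Compare.

Variables (f m1 m2 p U W : R -> R) (a L G : R).
Hypothesis nl : nonlin f a L.
Hypothesis wv : wave f m1 U W.
Hypothesis pf : profile f m2 p.
Hypothesis m1_bound : forall u, 0 <= u <= 1 -> Rabs (m1 u) <= G.

Let D := fun x => W x - p (U x).
Let hU := wave_strict01 f a L m1 U W G nl wv m1_bound.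

Lemma is_derive_gap x :
  is_derive D x (W x * (m2 (U x) - m1 (U x)) + f (U x) / p (U x) * D x).
Proof.
  assert (hp := pf_pos _ _ _ pf (U x) (hU x)).
  evar_last.
  - apply (is_derive_minus W (fun x => p (U x)) x).
    + apply wv.
    + apply (is_derive_comp p U).
      * apply pf, hU.
      * apply wv.
  - unfold minus, plus, opp, scal; simpl; unfold mult; simpl. unfold D. field. lra.
Qed.

Lemma gap_continuous x : continuous D x.
Proof. eapply is_derive_continuous, is_derive_gap. Qed.

Lemma is_lim_gap_m : is_lim D m_infty 0.
Proof.
  replace (Finite 0) with (Finite (0 - 0)) by (f_equal; ring).
  apply is_lim_minus'; [apply wv|].
  rewrite <- (pf_le0 _ _ _ pf 0 ltac:(lra)).
  apply (filterlim_comp _ _ _ U p _ (locally 0)); [apply wv|]. eapply profile_continuous, pf.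
Qed.

Lemma is_lim_gap_p : is_lim D p_infty 0.
Proof.
  replace (Finite 0) with (Finite (0 - 0)) by (f_equal; ring).
  apply is_lim_minus'; [apply wv|].
  rewrite <- (pf_ge1 _ _ _ pf 1 ltac:(lra)).
  apply (filterlim_comp _ _ _ U p _ (locally 1)); [apply wv|]. eapply profile_continuous, pf.
Qed.

(** Before the first passage through [a], f/p <= 0, so neither D nor -D can leave 0 coming from -oo;
    thus D vanishes at [x0]. The lower bound on p gives |f/p| <= 1/mu, and Gronwall's inequality for
    D^2 carries the zero to the whole orbit. *)
Lemma wave_profile_eq :
  (forall u, 0 <= u <= 1 -> m1 u = m2 u) -> forall x, W x = p (U x).
Proof.
  intros hm. destruct (wave_first_hit f m1 a U W wv (nl_a _ _ _ nl)) as (x0 & _ & hx0).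
  assert (dD : forall x, is_derive D x (f (U x) / p (U x) * D x)).
  { intros x. evar_last; [apply is_derive_gap|]. rewrite hm by (specialize (hU x); lra). simpl. ring. }
  assert (hf : forall x, x < x0 -> f (U x) / p (U x) <= 0).
  { intros x hx. assert (hp := pf_pos _ _ _ pf (U x) (hU x)). specialize (hx0 x hx).
    assert (f (U x) < 0) by (apply nl; split; [apply hU|exact hx0]).
    assert (0 < / p (U x)) by now apply Rinv_0_lt_compat. unfold Rdiv. nra. }
  assert (H1 : D x0 <= 0).
  { apply (barrier_m_infty D (fun x => f (U x) / p (U x) * D x)).
    - apply is_lim_gap_m.
    - intros x _. apply gap_continuous.
    - intros x _. apply dD.
    - intros x hx hD. specialize (hf x hx). nra. }
  assert (H2 : - D x0 <= 0).
  { apply (barrier_m_infty (fun x => - D x) (fun x => - (f (U x) / p (U x) * D x))).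
    - replace (Finite 0) with (Rbar_opp 0) by (simpl; f_equal; ring). apply is_lim_opp, is_lim_gap_m.
    - intros x _. apply (@continuous_opp _ R_AbsRing R_NormedModule), gap_continuous.
    - intros x _. apply (is_derive_opp D x _ (dD x)).
    - intros x hx hD. specialize (hf x hx). nra. }
  destruct (pf_lower _ _ _ pf) as (mu & hmu & hl).
  assert (hN : forall x, D x * D x = 0).
  { apply (gronwall_zero _ (fun x => 2 * (f (U x) / p (U x)) * (D x * D x)) (2 * / mu) x0).
    - intros x. evar_last.
      + apply (is_derive_mult D D x _ _ (dD x) (dD x)). intros; apply Rmult_comm.
      + unfold plus, mult; simpl. ring.
    - intros x. nra.
    - intros x. assert (hp := pf_pos _ _ _ pf (U x) (hU x)).
      assert (Q := hl (U x) ltac:(specialize (hU x); lra)).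
      rewrite !Rabs_mult, (Rabs_right 2) by lra. rewrite <- (Rabs_mult (D x)).
      rewrite (Rabs_right (D x * D x)) by nra.
      apply Rmult_le_compat_r; [nra|]. apply Rmult_le_compat_l; [lra|].
      unfold Rdiv. rewrite Rabs_mult, (Rabs_right (/ p (U x))) by (left; now apply Rinv_0_lt_compat).
      apply Rle_div_l; [lra|]. apply Rmult_le_reg_l with mu; [lra|].
      rewrite <- Rmult_assoc, Rinv_r, Rmult_1_l; lra.
    - replace (D x0) with 0 by lra. ring. }
  intros x. specialize (hN x). assert (D x = 0) by nra. unfold D in *. lra.
Qed.

(* [D] starts positive at the first passage through [a] and then can only grow. *)
Lemma wave_profile_lt : (forall u, 0 <= u <= 1 -> m1 u < m2 u) -> False.
Proof.
  intros hm. destruct (wave_first_hit f m1 a U W wv (nl_a _ _ _ nl)) as (x0 & Ex0 & hx0).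
  assert (hW : forall x, x < x0 -> 0 < W x).
  { apply (wave_increasing_left f a L m1 U W); auto. intros x hx. split; [apply hU|now apply hx0]. }
  assert (hm' : forall x, m1 (U x) < m2 (U x)) by (intros x; apply hm; specialize (hU x); lra).
  (* Left of [x0], both W (m2 - m1) and (f/p) D push D upwards when D < 0. *)
  assert (pos : forall b, b <= x0 -> 0 <= D b).
  { intros b hb. assert (Q : - D b <= 0); [|lra].
    apply (barrier_m_infty (fun x => - D x) (fun x => - (W x * (m2 (U x) - m1 (U x)) + f (U x) / p (U x) * D x))).
    - replace (Finite 0) with (Rbar_opp 0) by (simpl; f_equal; ring). apply is_lim_opp, is_lim_gap_m.
    - intros x _. apply (@continuous_opp _ R_AbsRing R_NormedModule), gap_continuous.
    - intros x _. apply (is_derive_opp D x _ (is_derive_gap x)).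
    - intros x hx hD. assert (hp := pf_pos _ _ _ pf (U x) (hU x)). specialize (hx0 x ltac:(lra)).
      specialize (hW x ltac:(lra)). specialize (hm' x).
      assert (f (U x) < 0) by (apply nl; split; [apply hU|exact hx0]).
      assert (0 < / p (U x)) by now apply Rinv_0_lt_compat.
      assert (f (U x) / p (U x) <= 0) by (unfold Rdiv; nra). nra. }
  assert (pa : 0 < p a) by (apply pf, nl).
  (* At a zero [x0] of D the derivative would be W (m2 - m1) > 0, making D negative just before. *)
  assert (Dpos : 0 < D x0).
  { destruct (Rle_lt_or_eq_dec _ _ (pos x0 ltac:(lra))) as [|E]; [easy|]. exfalso. symmetry in E.
    destruct (is_derive_pos_local D x0 _ (is_derive_gap x0)) as (d & hd & hl & _).
    - rewrite E. assert (W x0 = p a) by (unfold D in E; rewrite Ex0 in E; lra).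
      specialize (hm' x0). nra.
    - specialize (hl (x0 - d / 2) ltac:(lra)). specialize (pos (x0 - d / 2) ltac:(lra)). lra. }
  (* As long as D stays above half its value at [x0], W = p(U) + D > 0 keeps U above [a], where f >
     0; both terms of D' are then positive and the threshold cannot be reached. *)
  assert (grow : forall x, x0 <= x -> D x0 / 2 <= D x).
  { intros x hx. apply Rnot_lt_le. intros hlt.
    destruct (first_zero (fun y => D y - D x0 / 2) x0 x) as (c & hc & E & P); [lra| |lra|lra|].
    { intros y _. apply (continuous_minus D (fun _ => D x0 / 2)); [apply gap_continuous|apply continuous_const]. }
    assert (Wp : forall y, x0 <= y < c -> 0 < W y /\ 0 < D y).
    { intros y hy. specialize (P y hy). assert (hp := pf_pos _ _ _ pf (U y) (hU y)).
      split; [|lra]. unfold D in P at 1. lra. }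
    assert (Ua : forall y, x0 < y < c -> a < U y).
    { intros y hy. destruct (MVT_open U W x0 y) as (z & hz & Ez); [lra| | |].
      { intros z _. eapply is_derive_continuous, wv. } { intros z _. apply wv. }
      destruct (Wp z ltac:(lra)) as [h _]. nra. }
    destruct (MVT_open D _ x0 c ltac:(lra) (fun y _ => gap_continuous y) (fun y _ => is_derive_gap y)) as (z & hz & Ez).
    destruct (Wp z ltac:(lra)) as [h1 h2]. specialize (Ua z hz). specialize (hm' z).
    assert (hp := pf_pos _ _ _ pf (U z) (hU z)).
    assert (0 < f (U z)) by (apply (nl_right _ _ _ nl); split; [exact Ua|apply hU]).
    assert (0 < f (U z) / p (U z)) by now apply Rdiv_lt_0_compat.
    assert (0 < W z * (m2 (U z) - m1 (U z)) + f (U z) / p (U z) * D z) by nra. nra. }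
  destruct (is_lim_p_infty_bound D 0 (D x0 / 2) is_lim_gap_p) as [A hA]; [lra|].
  set (x := Rmax (A + 1) x0). assert (A + 1 <= x) by apply Rmax_l. assert (x0 <= x) by apply Rmax_r.
  specialize (hA x ltac:(lra)). apply Rabs_def2 in hA. specialize (grow x ltac:(lra)). lra.
Qed.

End Compare.

(** Reflection changes the sign of both dampings and hence reverses their order. *)
Lemma wave_profile_gt f m1 m2 p U W a L G :
  nonlin f a L -> wave f m1 U W -> profile f m2 p ->
  (forall u, 0 <= u <= 1 -> Rabs (m1 u) <= G) ->
  (forall u, 0 <= u <= 1 -> m2 u < m1 u) -> False.
Proof.
  intros nl wv pf hb hm.
  apply (wave_profile_lt _ _ _ _ _ _ _ _ G (nonlin_flip _ _ _ nl) (wave_flip _ _ _ _ wv) (profile_flip _ _ _ pf)).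
  - now apply flip_bound.
  - intros u hu. unfold flip. specialize (hm (1 - u)). lra.
Qed.

(** * Waves generated by a profile *)

(** 0 is an equilibrium of the Lipschitz field p; an orbit reaching it would coincide with it, by
    Gronwall's inequality for U^2. *)
Lemma ode_pos (p U : R -> R) K :
  (forall x y, Rabs (p x - p y) <= K * Rabs (x - y)) -> p 0 = 0 ->
  (forall x, is_derive U x (p (U x))) -> 0 < U 0 -> forall x, 0 < U x.
Proof.
  intros hK p0 hU u0 x. apply Rnot_le_lt. intros hx.
  assert (Uc : continuity U).
  { intros y. apply continuity_pt_filterlim. eapply is_derive_continuous, hU. }
  destruct (IVT_gen U 0 x 0 Uc) as (z & _ & Ez).
  { split; [apply Rle_trans with (2 := hx), Rmin_r|]. apply Rle_trans with (U 0); [lra|apply Rmax_l]. }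
  assert (hN : U 0 * U 0 = 0).
  { apply (gronwall_zero (fun y => U y * U y) (fun y => 2 * U y * p (U y)) (2 * K) z).
    - intros y. evar_last.
      + apply (is_derive_mult U U y _ _ (hU y) (hU y)). intros; apply Rmult_comm.
      + unfold plus, mult; simpl. ring.
    - intros y. nra.
    - intros y. specialize (hK (U y) 0). rewrite p0, !Rminus_0_r in hK.
      rewrite !Rabs_mult, (Rabs_right 2) by lra.
      replace (2 * K * (U y * U y)) with (2 * Rabs (U y) * (K * Rabs (U y))).
      + apply Rmult_le_compat_l; [|exact hK]. assert (Q := Rabs_pos (U y)). lra.
      + assert (Q : Rabs (U y) * Rabs (U y) = U y * U y) by (rewrite <- Rabs_mult; apply Rabs_right; nra).
        rewrite <- Q. ring.
    - rewrite Ez. ring. }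
  nra.
Qed.

(** U increases. If it stayed below 1 - e, the field would be at least its positive minimum [p z]
    between [U 0] and [1 - e], and in time [/ p z] the orbit would gain 1, too much for values in
    (0,1). *)
Lemma ode_lim_p (p U : R -> R) :
  (forall u, continuous p u) -> (forall u, 0 < u < 1 -> 0 < p u) ->
  (forall x, is_derive U x (p (U x))) -> (forall x, 0 < U x < 1) -> is_lim U p_infty 1.
Proof.
  intros pc pp hU h01. apply is_lim_p_infty_intro. intros e he.
  assert (incr : forall x y, x <= y -> U x <= U y).
  { intros x y hxy. destruct (Req_dec x y) as [->|hne]; [lra|].
    destruct (MVT_open U (fun x => p (U x)) x y) as (c & hc & E); [lra| | |].
    { intros c _. eapply is_derive_continuous, hU. } { intros c _. apply hU. }
    specialize (pp (U c) (h01 c)). nra. }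
  destruct (classic (exists x, 1 - e < U x)) as [[A hA]|hn].
  - exists A. intros x hx. specialize (incr A x ltac:(lra)). specialize (h01 x). apply Rabs_def1; lra.
  - exfalso. assert (hb : forall x, U x <= 1 - e).
    { intros x. apply Rnot_lt_le. intros h. apply hn. now exists x. }
    destruct (continuity_ab_min p (U 0) (1 - e)) as (z & hz & hzi); [apply hb| |].
    { intros c _. apply continuity_pt_filterlim, pc. }
    assert (hp : 0 < p z) by (apply pp; specialize (h01 0); lra).
    assert (hi : 0 < / p z) by now apply Rinv_0_lt_compat.
    destruct (MVT_open U (fun x => p (U x)) 0 (/ p z)) as (c & hc & E); [lra| | |].
    { intros c _. eapply is_derive_continuous, hU. } { intros c _. apply hU. }
    assert (p z <= p (U c)) by (apply hz; split; [apply incr; lra|apply hb]).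
    assert (1 <= p (U c) * (/ p z - 0)).
    { rewrite Rminus_0_r. rewrite <- (Rinv_r (p z)) by lra. apply Rmult_le_compat_r; lra. }
    assert (h1 := h01 0). assert (h2 := h01 (/ p z)). lra.
Qed.

Theorem profile_wave f a L m p : nonlin f a L -> profile f m p ->
  exists U, wave f m U (fun x => p (U x)).
Proof.
  intros nl pf. destruct (pf_lip _ _ _ pf) as [K hK].
  assert (pc : forall u, continuous p u) by (intros u; eapply profile_continuous, pf).
  assert (p0 := pf_le0 _ _ _ pf 0 ltac:(lra)). assert (p1 := pf_ge1 _ _ _ pf 1 ltac:(lra)).
  assert (ha := nl_a _ _ _ nl).
  assert (HK := Rabs_pos K).
  (* Starting from [a] puts the orbit inside (0,1). The field is bounded by [Rabs K] because it
     vanishes at 0 and outside [0,1]. *)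
  destruct (picard (fun _ y => p y) (Rabs K + 1) (Rabs K) a) as [U [U0 hU]].
  - lra.
  - intros u y. apply (continuous_comp snd p); [apply continuous_snd|apply pc].
  - intros _ y z. apply Rle_trans with (1 := hK y z). apply Rmult_le_compat_r; [apply Rabs_pos|].
    assert (Q := Rle_abs K). lra.
  - intros _ y. destruct (Rle_dec y 0) as [h|h].
    { rewrite (pf_le0 _ _ _ pf y h), Rabs_R0. lra. }
    destruct (Rle_dec 1 y) as [h'|h'].
    { rewrite (pf_ge1 _ _ _ pf y h'), Rabs_R0. lra. }
    specialize (hK y 0). rewrite p0, !Rminus_0_r, (Rabs_right y) in hK by lra.
    apply Rle_trans with (1 := hK). assert (Q := Rle_abs K). nra.
  - assert (rU : forall x, is_derive (rev1 U) x (p (1 - rev1 U x))).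
    { intros x. unfold rev1 at 2. replace (1 - (1 - U (0 - x))) with (U (0 - x)) by ring.
      apply is_derive_rev1, hU. }
    assert (h01 : forall x, 0 < U x < 1).
    { intros x. split.
      - apply (ode_pos p U K); auto. lra.
      - assert (Q : 0 < rev1 U (- x)).
        { apply (ode_pos (fun u => p (1 - u)) (rev1 U) K).
          - intros y z. apply Rle_trans with (1 := hK _ _).
            replace (1 - y - (1 - z)) with (- (y - z)) by ring. rewrite Rabs_Ropp. lra.
          - now rewrite Rminus_0_r.
          - exact rU.
          - unfold rev1. rewrite Rminus_0_r, U0. lra. }
        unfold rev1 in Q. replace (0 - - x) with x in Q by ring. lra. }
    assert (l1 : is_lim U p_infty 1).
    { apply (ode_lim_p p U); auto. apply pf. }
    assert (l0 : is_lim U m_infty 0).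
    { assert (Q : is_lim (rev1 U) p_infty 1).
      { apply (ode_lim_p (fun u => p (1 - u)) (rev1 U)).
        - intros u. apply (continuous_comp (fun u => 1 - u) p); [|apply pc].
          apply (@ex_derive_continuous R_AbsRing R_NormedModule). auto_derive. trivial.
        - intros u hu. apply pf. lra.
        - exact rU.
        - intros x. unfold rev1. specialize (h01 (0 - x)). lra. }
      apply is_lim_rev1_m in Q. replace (1 - 1) with 0 in Q by ring.
      apply is_lim_ext with (2 := Q). intros x. unfold rev1.
      replace (0 - (0 - x)) with x by ring. ring. }
    exists U. constructor; auto.
    + intros x. assert (hp := pf_pos _ _ _ pf (U x) (h01 x)). evar_last.
      * apply (is_derive_comp p U); [apply pf, h01|apply hU].
      * unfold scal; simpl; unfold mult; simpl. field. lra.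
    + rewrite <- p0. apply (filterlim_comp _ _ _ U p _ (locally 0)); [exact l0|apply pc].
    + rewrite <- p1. apply (filterlim_comp _ _ _ U p _ (locally 1)); [exact l1|apply pc].
Qed.

(** * Fronts of the hyperbolic and parabolic problems *)

(** Near 0, f'(0) < 0 gives -f >= b u with b half of |f'(0)|, and the profile dominates mu |f|; away
    from 0 a positive minimum on a compact interval suffices. The profile vanishes at 1, hence the
    restriction to [u1 < 1]. *)
Lemma profile_linear_lower (f : R -> R) (a L : R) (m p : R -> R) (u1 : R) : nonlin f a L -> profile f m p -> u1 < 1 ->
  exists kappa, 0 < kappa /\ forall u, 0 <= u <= u1 -> kappa * u <= p u.
Proof.
  intros nl pf hu1. destruct (pf_lower _ _ _ pf) as (mu & hmu & hl).
  assert (d0 := nl_d0 _ _ _ nl).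
  set (b := - Derive f 0 / 2). assert (hb : 0 < b) by (unfold b; lra).
  destruct (is_derive_pos_local (fun u => - f u - b * u) 0 b) as (d & hd & _ & hr); [|exact hb|].
  { evar_last.
    - apply (is_derive_minus (fun u => - f u) (fun u => b * u) 0 (- Derive f 0) b).
      + apply (is_derive_opp f 0 (Derive f 0)), Derive_correct, nl.
      + auto_derive; trivial. ring.
    - unfold b, minus, plus, opp; simpl. field. }
  rewrite (nl_f0 _ _ _ nl) in hr.
  assert (near : forall u, 0 <= u <= d / 2 -> u <= u1 -> mu * b * u <= p u).
  { intros u hu hu'. destruct (Req_dec u 0) as [->|hne].
    - rewrite (pf_le0 _ _ _ pf 0) by lra. lra.
    - specialize (hr u ltac:(lra)). apply Rle_trans with (2 := hl u ltac:(lra)).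
      rewrite Rmult_assoc. apply Rmult_le_compat_l; [lra|].
      rewrite <- Rabs_Ropp. apply Rle_trans with (2 := Rle_abs _). lra. }
  assert (hmb : 0 < mu * b) by now apply Rmult_lt_0_compat.
  destruct (Rle_dec (d / 2) u1) as [h|h].
  - destruct (continuity_ab_min p (d / 2) u1 h) as (z & hz & hzi).
    { intros c _. apply continuity_pt_filterlim. eapply profile_continuous, pf. }
    assert (hp : 0 < p z) by (apply pf; lra).
    exists (Rmin (mu * b) (p z)). split; [now apply Rmin_glb_lt|].
    assert (r1 := Rmin_l (mu * b) (p z)). assert (r2 := Rmin_r (mu * b) (p z)).
    intros u hu. destruct (Rle_dec u (d / 2)) as [h'|h'].
    + apply Rle_trans with (2 := near u ltac:(lra) ltac:(lra)). apply Rmult_le_compat_r; lra.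
    + apply Rle_trans with (2 := hz u ltac:(lra)).
      apply Rle_trans with (p z * u); [apply Rmult_le_compat_r; lra|]. nra.
  - exists (mu * b). split; [exact hmb|]. intros u hu. apply near; lra.
Qed.

(** For x <= 0 the orbit stays below [U 0], so U' >= kappa U there and U exp(-k x) is nondecreasing
    on that half line. Any smaller rate [k] is allowed so that the two ends can later share one. *)
Lemma exp_decay_m (f : R -> R) (a L : R) (m p U : R -> R) : nonlin f a L -> profile f m p ->
  (forall x, is_derive U x (p (U x))) -> (forall x, 0 < U x < 1) ->
  exists kappa, 0 < kappa /\ forall k x, k <= kappa -> x <= 0 -> U x <= exp (k * x).
Proof.
  intros nl pf hU h01.
  destruct (profile_linear_lower f a L m p (U 0) nl pf) as (kappa & hk & hp); [apply h01|].
  assert (incr : forall x y, x <= y -> U x <= U y).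
  { intros x y hxy. destruct (Req_dec x y) as [->|hne]; [lra|].
    destruct (MVT_open U (fun x => p (U x)) x y) as (c & hc & E); [lra| | |].
    { intros c _. eapply is_derive_continuous, hU. } { intros c _. apply hU. }
    assert (Q := pf_pos _ _ _ pf (U c) (h01 c)). nra. }
  exists kappa. split; [exact hk|]. intros k x hkk hx.
  set (phi := fun x => U x * exp (- k * x)).
  assert (dphi : forall x, is_derive phi x ((p (U x) - k * U x) * exp (- k * x))).
  { intros y. evar_last.
    - apply (is_derive_mult U (fun y => exp (- k * y)) y (p (U y)) (- k * exp (- k * y))).
      + apply hU.
      + auto_derive; trivial. ring.
      + intros; apply Rmult_comm.
    - unfold plus, mult; simpl. ring. }
  assert (Q : phi x <= phi 0).
  { destruct (Req_dec x 0) as [->|hne]; [lra|].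
    destruct (MVT_open phi _ x 0 ltac:(lra) (fun y _ => is_derive_continuous _ _ _ (dphi y)) (fun y _ => dphi y))
      as (c & hc & E).
    assert (hc1 := incr c 0 ltac:(lra)). assert (hc0 := h01 c).
    specialize (hp (U c) ltac:(lra)). assert (he := exp_pos (- k * c)).
    assert (k * U c <= kappa * U c) by (apply Rmult_le_compat_r; lra).
    assert (0 <= (p (U c) - k * U c) * exp (- k * c)) by (apply Rmult_le_pos; lra). nra. }
  unfold phi in Q. rewrite Rmult_0_r, exp_0, Rmult_1_r in Q. specialize (h01 0).
  replace (U x) with (U x * exp (- k * x) * exp (k * x)).
  - assert (he := exp_pos (k * x)). nra.
  - rewrite Rmult_assoc, <- exp_plus. replace (- k * x + k * x) with 0 by ring. rewrite exp_0. ring.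
Qed.

Lemma exp_decay (f : R -> R) (a L : R) (m p U : R -> R) : nonlin f a L -> profile f m p ->
  (forall x, is_derive U x (p (U x))) -> (forall x, 0 < U x < 1) ->
  exists kappa, 0 < kappa /\ (forall x, x <= 0 -> U x <= exp (kappa * x)) /\
    (forall x, 0 <= x -> 1 - U x <= exp (- (kappa * x))).
Proof.
  intros nl pf hU h01.
  destruct (exp_decay_m f a L m p U nl pf hU h01) as (k1 & hk1 & d1).
  destruct (exp_decay_m _ _ _ _ _ (rev1 U) (nonlin_flip _ _ _ nl) (profile_flip _ _ _ pf)) as (k2 & hk2 & d2).
  { intros x. unfold rev1 at 2. replace (1 - (1 - U (0 - x))) with (U (0 - x)) by ring.
    apply is_derive_rev1, hU. }
  { intros x. unfold rev1. specialize (h01 (0 - x)). lra. }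
  exists (Rmin k1 k2). split; [now apply Rmin_glb_lt|]. split.
  - intros x hx. apply d1; [apply Rmin_l|exact hx].
  - intros x hx. specialize (d2 (Rmin k1 k2) (- x) (Rmin_r _ _) ltac:(lra)).
    unfold rev1 in d2. replace (0 - - x) with x in d2 by ring.
    replace (Rmin k1 k2 * - x) with (- (Rmin k1 k2 * x)) in d2 by ring. exact d2.
Qed.

Lemma is_lim_scale_p (phi : R -> R) (r l : R) :
  0 < r -> is_lim phi p_infty l -> is_lim (fun y => phi (r * y)) p_infty l.
Proof.
  intros hr h. apply is_lim_p_infty_intro. intros e he.
  destruct (is_lim_p_infty_bound phi l e h he) as [A hA].
  exists (A / r). intros x hx. apply hA. apply Rlt_div_l in hx; lra.
Qed.

Lemma is_lim_scale_m (phi : R -> R) (r l : R) :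
  0 < r -> is_lim phi m_infty l -> is_lim (fun y => phi (r * y)) m_infty l.
Proof.
  intros hr h. apply is_lim_m_infty_intro. intros e he.
  destruct (is_lim_m_infty_bound phi l e h he) as [A hA].
  exists (A / r). intros x hx. apply hA. apply Rlt_div_r in hx; lra.
Qed.

Lemma is_derive_scale (phi : R -> R) (r x l : R) :
  is_derive phi (r * x) l -> is_derive (fun y => phi (r * y)) x (r * l).
Proof.
  intros h. assert (Hr : is_derive (fun y : R => r * y) x r) by (auto_derive; trivial; ring).
  exact (is_derive_comp phi (fun y => r * y) x l r h Hr).
Qed.

Definition damping (f : R -> R) (tau s u : R) : R := s * (1 - tau * Derive f u).

(** * Fronts of the hyperbolic system as waves *)

Section HypFront.

Variables (f : R -> R) (a L tau c : R) (U V : R -> R).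
Hypothesis nl : nonlin f a L.
Hypothesis k_pos : 0 < 1 - c * c * tau.
Hypothesis hf : hyp_front f tau c U V.

Let k := 1 - c * c * tau.
Let r := sqrt k.

Lemma hyp_front_U x : is_derive U x (Derive U x).
Proof. apply Derive_correct, (proj1 hf). Qed.

Lemma hyp_front_DV x : Derive V x = - f (U x) - c * Derive U x.
Proof. destruct hf as [h _]. destruct (h x) as (_ & _ & e1 & _). lra. Qed.

Lemma hyp_front_V x : is_derive V x (- f (U x) - c * Derive U x).
Proof. rewrite <- hyp_front_DV. apply Derive_correct, (proj1 hf). Qed.

Lemma hyp_front_V_eq x : V x = k * Derive U x - c * tau * f (U x).
Proof.
  destruct hf as [h _]. destruct (h x) as (_ & _ & _ & e2).
  rewrite hyp_front_DV in e2. unfold k. lra.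
Qed.

Lemma hyp_front_DU x : Derive U x = (V x + c * tau * f (U x)) / k.
Proof. rewrite hyp_front_V_eq. field. unfold k; lra. Qed.

(** A front is only assumed once differentiable; U' is differentiable because the two equations
    express it through V and f(U), after division by [k]. *)
Lemma hyp_front_DDU x : is_derive (Derive U) x
  ((- f (U x) - c * Derive U x + c * tau * (Derive f (U x) * Derive U x)) / k).
Proof.
  apply (is_derive_ext (fun x => / k * (V x + c * tau * f (U x)))).
  { intros t. rewrite (hyp_front_DU t). unfold Rdiv. apply Rmult_comm. }
  evar_last.
  - apply (is_derive_scal (fun x => V x + c * tau * f (U x)) x (/ k)).
    apply (is_derive_plus V (fun x => c * tau * f (U x))); [apply hyp_front_V|].
    apply (is_derive_scal (fun x => f (U x))).
    apply (is_derive_comp f U); [apply Derive_correct, nl|apply hyp_front_U].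
  - unfold plus, scal; simpl; unfold mult; simpl. unfold Rdiv. ring.
Qed.

Lemma hyp_front_lim_DU (x : Rbar) (u : R) :
  f u = 0 -> is_lim U x u -> is_lim V x 0 -> is_lim (Derive U) x 0.
Proof.
  intros h1 h2 h3.
  apply (is_lim_ext (fun x => / k * (V x + c * tau * f (U x)))).
  { intros t. rewrite (hyp_front_DU t). unfold Rdiv. apply Rmult_comm. }
  replace (Finite 0) with (Rbar_mult (/ k) (0 + c * tau * f u)) by (simpl; f_equal; rewrite h1; ring).
  apply is_lim_scal_l. apply is_lim_plus'; [exact h3|].
  replace (Finite (c * tau * f u)) with (Rbar_mult (c * tau) (f u)) by reflexivity.
  apply is_lim_scal_l. apply (filterlim_comp _ _ _ U f _ (locally u)); [exact h2|].
  apply (@ex_derive_continuous R_AbsRing R_NormedModule), nl.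
Qed.

Lemma hyp_front_wave :
  wave f (damping f tau (c / r)) (fun y => U (r * y)) (fun y => r * Derive U (r * y)).
Proof.
  assert (hr : 0 < r) by now apply sqrt_lt_R0.
  assert (hrr : r * r = k) by (apply sqrt_sqrt; unfold k; lra).
  destruct hf as (_ & u0 & v0 & u1 & v1).
  constructor.
  - intros y. apply is_derive_scale, hyp_front_U.
  - intros y. evar_last.
    + apply (is_derive_scal (fun y => Derive U (r * y))). apply is_derive_scale, hyp_front_DDU.
    + rewrite <- hrr. unfold damping. simpl. field. lra.
  - now apply is_lim_scale_m.
  - now apply is_lim_scale_p.
  - replace (Finite 0) with (Rbar_mult r 0) by (simpl; f_equal; ring).
    apply is_lim_scal_l, is_lim_scale_m; auto. apply (hyp_front_lim_DU _ 0); auto. apply nl.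
  - replace (Finite 0) with (Rbar_mult r 0) by (simpl; f_equal; ring).
    apply is_lim_scal_l, is_lim_scale_p; auto. apply (hyp_front_lim_DU _ 1); auto. apply nl.
Qed.

End HypFront.

Lemma wave_hyp_front (f : R -> R) (a L tau s : R) (U W : R -> R) : nonlin f a L -> 0 <= tau ->
  wave f (damping f tau s) U W ->
  exists U1 V1, hyp_front f tau (s / sqrt (1 + tau * (s * s))) U1 V1.
Proof.
  intros nl ht [dU dW u0 u1 w0 w1].
  assert (hss : 0 <= tau * (s * s)) by (apply Rmult_le_pos; [lra|apply (Rle_0_sqr s)]).
  (* For c = s / q, [q] is the inverse of sqrt(1 - c^2 tau); the flux below is read off from V = (1
     - c^2 tau) U' - c tau f(U). *)
  set (q := sqrt (1 + tau * (s * s))).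
  assert (hq : 0 < q) by (apply sqrt_lt_R0; lra).
  assert (hqq : q * q = 1 + tau * (s * s)) by (apply sqrt_sqrt; lra).
  set (c := s / q).
  set (V1 := fun x => / q * W (q * x) - c * tau * f (U (q * x))).
  assert (d1 : forall x, is_derive (fun x => U (q * x)) x (q * W (q * x))).
  { intros x. apply is_derive_scale, dU. }
  assert (d2 : forall x, is_derive V1 x
    (/ q * (q * (- damping f tau s (U (q * x)) * W (q * x) - f (U (q * x)))) -
     c * tau * ((q * W (q * x)) * Derive f (U (q * x))))).
  { intros x. apply (is_derive_minus (fun x => / q * W (q * x)) (fun x => c * tau * f (U (q * x)))).
    - apply (is_derive_scal (fun x => W (q * x))). apply is_derive_scale, dW.
    - apply (is_derive_scal (fun x => f (U (q * x)))).
      apply (is_derive_comp f (fun x => U (q * x))); [apply Derive_correct, nl|apply d1]. }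
  assert (limV : forall (x : Rbar) (u : R), f u = 0 -> is_lim (fun x => U (q * x)) x u ->
    is_lim (fun x => W (q * x)) x 0 -> is_lim V1 x 0).
  { intros x u e h1 h2. replace (Finite 0) with (Finite (/ q * 0 - c * tau * f u)) by (f_equal; rewrite e; ring).
    apply is_lim_minus'.
    - apply (is_lim_scal_l (fun x => W (q * x)) (/ q) x 0 h2).
    - apply (is_lim_scal_l (fun x => f (U (q * x))) (c * tau) x (f u)).
      apply (filterlim_comp _ _ _ (fun x => U (q * x)) f _ (locally u)); [exact h1|].
      apply (@ex_derive_continuous R_AbsRing R_NormedModule), nl. }
  exists (fun x => U (q * x)), V1. split.
  - intros x.
    assert (D1 : Derive (fun x : R => U (q * x)) x = q * W (q * x)) by (apply is_derive_unique, d1).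
    assert (D2 := is_derive_unique _ _ _ (d2 x)).
    split; [|split; [|split]].
    + eexists; apply d1.
    + eexists; apply d2.
    + rewrite D1, D2.
      unfold damping, c. field. lra.
    + rewrite D1, D2.
      unfold V1, damping, c.
      (* The terms with f and f' cancel, and the residual vanishes because q^2 = 1 + tau s^2. *)
      replace (q * W (q * x) + s / q * tau *
        (/ q * (q * (- (s * (1 - tau * Derive f (U (q * x)))) * W (q * x) - f (U (q * x)))) -
         s / q * tau * (q * W (q * x) * Derive f (U (q * x)))) -
        (/ q * W (q * x) - s / q * tau * f (U (q * x))))
      with ((q * q - 1 - tau * (s * s)) * W (q * x) / q) by (field; lra).
      rewrite hqq. field. lra.
  - split; [|split; [|split]].
    + now apply is_lim_scale_m.
    + apply (limV _ 0); [apply nl|now apply is_lim_scale_m|now apply is_lim_scale_m].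
    + now apply is_lim_scale_p.
    + apply (limV _ 1); [apply nl|now apply is_lim_scale_p|now apply is_lim_scale_p].
Qed.

(** * Positivity of the flux V *)

(** While U <= a, f <= 0 makes V at least k U' > 0. Once U > a, V' = -f - c U' < 0 from there on,
    and a strictly decreasing function with limit 0 is positive. *)
Lemma flux_pos_aux (f : R -> R) (a L tau c k : R) (U A V : R -> R) : nonlin f a L -> 0 <= tau -> 0 < k -> 0 <= c ->
  (forall x, is_derive U x (A x)) -> (forall x, is_derive V x (- f (U x) - c * A x)) ->
  (forall x, V x = k * A x - c * tau * f (U x)) ->
  (forall x, 0 < A x) -> (forall x, 0 < U x < 1) -> is_lim V p_infty 0 ->
  forall x, 0 < V x.
Proof.
  intros nl ht hk hc dU dV E hA h01 lV x. assert (ha := nl_a _ _ _ nl).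
  assert (hct : 0 <= c * tau) by now apply Rmult_le_pos.
  destruct (Rle_dec (U x) a) as [h|h].
  - rewrite E. specialize (hA x). specialize (h01 x).
    assert (f (U x) <= 0) by (apply (half_f_neg0 f a); [lra|apply nl|apply nl|apply nl|lra]).
    assert (0 < k * A x) by now apply Rmult_lt_0_compat.
    assert (0 <= c * tau * - f (U x)) by (apply Rmult_le_pos; lra). lra.
  - assert (decr : forall y z, x <= y -> y < z -> V z < V y).
    { intros y z hy hz.
      destruct (MVT_open V _ y z hz (fun y _ => is_derive_continuous _ _ _ (dV y)) (fun y _ => dV y)) as (w & hw & Ew).
      destruct (MVT_open U _ x w ltac:(lra) (fun y _ => is_derive_continuous _ _ _ (dU y)) (fun y _ => dU y)) as (w' & hw' & Ew').
      specialize (hA w') as hA'. specialize (hA w).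
      assert (a < U w) by nra.
      assert (0 < f (U w)) by (apply (nl_right _ _ _ nl); split; [easy|apply h01]).
      assert (0 <= c * A w) by (apply Rmult_le_pos; lra). nra. }
    apply Rnot_le_lt. intros hV.
    assert (hV1 := decr x (x + 1) ltac:(lra) ltac:(lra)).
    destruct (is_lim_p_infty_bound V 0 (- V (x + 1)) lV) as [B hB]; [lra|].
    set (y := Rmax (B + 1) (x + 2)). assert (B + 1 <= y) by apply Rmax_l. assert (x + 2 <= y) by apply Rmax_r.
    specialize (hB y ltac:(lra)). apply Rabs_def2 in hB.
    assert (hV2 := decr (x + 1) y ltac:(lra) ltac:(lra)). lra.
Qed.

(** For negative [c], reflecting x and U changes [c] into [- c] and keeps the values of V, so the
    case of nonnegative speed applies. *)
Lemma flux_pos (f : R -> R) (a L tau c k : R) (U A V : R -> R) : nonlin f a L -> 0 <= tau -> 0 < k ->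
  (forall x, is_derive U x (A x)) -> (forall x, is_derive V x (- f (U x) - c * A x)) ->
  (forall x, V x = k * A x - c * tau * f (U x)) ->
  (forall x, 0 < A x) -> (forall x, 0 < U x < 1) ->
  is_lim V m_infty 0 -> is_lim V p_infty 0 ->
  forall x, 0 < V x.
Proof.
  intros nl ht hk dU dV E hA h01 lm lp x.
  destruct (Rle_dec 0 c) as [h|h].
  - now apply (flux_pos_aux f a L tau c k U A V).
  - assert (Q : 0 < (fun x => V (0 - x)) (- x)).
    { apply (flux_pos_aux (flip f) (1 - a) L tau (- c) k (rev1 U) (fun x => A (0 - x)) (fun x => V (0 - x))); auto.
      - now apply nonlin_flip.
      - lra.
      - intros y. apply is_derive_rev1, dU.
      - intros y. evar_last; [apply is_derive_reflect, dV|].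
        unfold flip, rev1. replace (1 - (1 - U (0 - y))) with (U (0 - y)) by ring. ring.
      - intros y. rewrite E. unfold flip, rev1. replace (1 - (1 - U (0 - y))) with (U (0 - y)) by ring. ring.
      - intros y. unfold rev1. specialize (h01 (0 - y)). lra.
      - now apply is_lim_reflect_p. }
    simpl in Q. now replace (0 - - x) with x in Q by ring.
Qed.

(** A parabolic front carries no assumption on its slope at infinity. On [x, x+1] the slope at some
    point equals U(x+1) - U(x), which is small, and W + c U has derivative -h, so W barely changes
    between that point and x. *)
Lemma parabolic_slope_lim_p (U W h : R -> R) (c l : R) :
  (forall x, is_derive U x (W x)) -> (forall x, is_derive W x (- c * W x - h x)) ->
  is_lim U p_infty l -> is_lim h p_infty 0 -> is_lim W p_infty 0.
Proof.
  intros dU dW lU lh. apply is_lim_p_infty_intro. intros e he.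
  assert (Hc := Rabs_pos c).
  (* The three errors 2 d, 2 |c| d and e/4 then add up to e/2. *)
  set (d := e / (8 * (1 + Rabs c))).
  assert (hd : 0 < d) by (apply Rdiv_lt_0_compat; lra).
  assert (Ed : (1 + Rabs c) * d = e / 8) by (unfold d; field; lra).
  destruct (is_lim_p_infty_bound U l d lU hd) as [A hA].
  destruct (is_lim_p_infty_bound h 0 (e / 4) lh) as [B hB]; [lra|].
  exists (Rmax A B). intros x hx. assert (A <= Rmax A B) by apply Rmax_l. assert (B <= Rmax A B) by apply Rmax_r.
  destruct (MVT_open U W x (x + 1)) as (xi & hxi & E1); [lra| | |].
  { intros y _. eapply is_derive_continuous, dU. } { intros y _. apply dU. }
  assert (dT : forall y, is_derive (fun y => W y + c * U y) y (- h y)).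
  { intros y. evar_last.
    - apply (is_derive_plus W (fun y => c * U y)); [apply dW|].
      apply (is_derive_scal U), dU.
    - unfold plus; simpl. ring. }
  destruct (MVT_open _ _ x xi ltac:(lra) (fun y _ => is_derive_continuous _ _ _ (dT y)) (fun y _ => dT y)) as (eta & heta & E2).
  assert (a1 := hA x ltac:(lra)). assert (a2 := hA (x + 1) ltac:(lra)). assert (a3 := hA xi ltac:(lra)).
  assert (a4 := hB eta ltac:(lra)).
  assert (w1 : Rabs (W xi) <= 2 * d).
  { replace (W xi) with (U (x + 1) - U x) by lra.
    apply Rabs_def2 in a1. apply Rabs_def2 in a2. apply Rabs_le. lra. }
  assert (w2 : Rabs (c * (U xi - U x)) <= Rabs c * (2 * d)).
  { rewrite Rabs_mult. apply Rmult_le_compat_l; [lra|].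
    apply Rabs_def2 in a1. apply Rabs_def2 in a3. apply Rabs_le. lra. }
  assert (w3 : Rabs (h eta * (xi - x)) <= e / 4).
  { rewrite Rminus_0_r in a4. rewrite Rabs_mult, (Rabs_right (xi - x)) by lra.
    assert (q := Rabs_pos (h eta)). nra. }
  replace (W x - 0) with (W xi + (c * (U xi - U x) + h eta * (xi - x))) by lra.
  apply Rle_lt_trans with (1 := Rabs_triang _ _).
  assert (q := Rabs_triang (c * (U xi - U x)) (h eta * (xi - x))). lra.
Qed.

Lemma parabolic_wave (f : R -> R) (a L c : R) (U : R -> R) : nonlin f a L -> parabolic_front f c U ->
  wave f (damping f 0 c) U (Derive U).
Proof.
  intros nl (h & u0 & u1).
  assert (fc : forall u, continuous f u).
  { intros u. apply (@ex_derive_continuous R_AbsRing R_NormedModule), nl. }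
  assert (dU : forall x, is_derive U x (Derive U x)) by (intros x; apply Derive_correct, h).
  assert (dW : forall x, is_derive (Derive U) x (- c * Derive U x - f (U x))).
  { intros x. destruct (h x) as (_ & h2 & h3).
    replace (- c * Derive U x - f (U x)) with (Derive (Derive U) x) by lra.
    now apply Derive_correct. }
  assert (l0 : is_lim (fun x => f (U x)) m_infty 0).
  { rewrite <- (nl_f0 _ _ _ nl). apply (filterlim_comp _ _ _ U f _ (locally 0)); [exact u0|apply fc]. }
  assert (l1 : is_lim (fun x => f (U x)) p_infty 0).
  { rewrite <- (nl_f1 _ _ _ nl). apply (filterlim_comp _ _ _ U f _ (locally 1)); [exact u1|apply fc]. }
  constructor; auto.
  - intros x. evar_last; [apply dW|]. unfold damping. simpl. ring.
  - assert (Q : is_lim (fun x => - Derive U (0 - x)) p_infty 0).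
    { apply (parabolic_slope_lim_p (fun x => U (0 - x)) _ (fun x => f (U (0 - x))) (- c) 0).
      - intros x. apply is_derive_reflect, dU.
      - intros x. evar_last.
        + apply (is_derive_opp (fun x => Derive U (0 - x))). apply is_derive_reflect, dW.
        + unfold opp; simpl. ring.
      - now apply is_lim_reflect_p.
      - now apply (is_lim_reflect_p (fun x => f (U x))). }
    apply is_lim_reflect_m, is_lim_opp in Q. simpl in Q. rewrite Ropp_0 in Q.
    apply is_lim_ext with (2 := Q). intros x. rewrite Ropp_involutive. f_equal. ring.
  - now apply (parabolic_slope_lim_p U _ (fun x => f (U x)) c 1).
Qed.

(** * Speeds *)

Lemma smooth_ex_derive f u : smooth f -> ex_derive f u.
Proof. intros h. exact (h 1%nat u). Qed.

Lemma smooth_continuous_Derive f u : smooth f -> continuous (Derive f) u.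
Proof.
  intros h. apply (@ex_derive_continuous R_AbsRing R_NormedModule).
  exact (h 2%nat u).
Qed.

(** The point is that the supremum is finite, since [real] sends infinite values to 0; continuity of
    f' on [0,1] provides an attained maximum. *)
Lemma sup_abs_deriv01_bound f u :
  smooth f -> 0 <= u <= 1 -> Rabs (Derive f u) <= real (sup_abs_deriv01 f).
Proof.
  intros hs hu.
  destruct (continuity_ab_maj (fun u => Rabs (Derive f u)) 0 1) as (z & hz & _); [lra| |].
  { intros c _. apply continuity_pt_filterlim.
    apply (continuous_comp (Derive f) Rabs); [now apply smooth_continuous_Derive|apply continuous_Rabs]. }
  unfold sup_abs_deriv01.
  destruct (Lub_Rbar_correct (fun y => exists u, 0 <= u <= 1 /\ y = Rabs (Derive f u))) as [h1 h2].
  assert (Q1 : Rbar_le (Rabs (Derive f u)) (Lub_Rbar (fun y => exists u, 0 <= u <= 1 /\ y = Rabs (Derive f u)))).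
  { apply h1. now exists u. }
  assert (Q2 : Rbar_le (Lub_Rbar (fun y => exists u, 0 <= u <= 1 /\ y = Rabs (Derive f u))) (Rabs (Derive f z))).
  { apply h2. intros y (v & hv & ->). now apply hz. }
  destruct (Lub_Rbar _) as [l| |]; simpl in *; [exact Q1|easy|easy].
Qed.

Lemma bistable_nonlin f alpha :
  smooth f -> bistable f alpha -> nonlin f alpha (real (sup_abs_deriv01 f)).
Proof.
  intros hs (h1 & h2 & h3 & h4 & h5 & h6 & h7 & h8 & h9 & h10 & h11). constructor; auto.
  - intros u. now apply smooth_ex_derive.
  - intros u hu. now apply sup_abs_deriv01_bound.
Qed.

Lemma damping_lower f S tau u : (forall u, 0 <= u <= 1 -> Rabs (Derive f u) <= S) ->
  0 <= tau -> 0 <= u <= 1 -> 1 - tau * S <= 1 - tau * Derive f u <= 1 + tau * S.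
Proof.
  intros hS ht hu. specialize (hS u hu). apply Rabs_le_between in hS. nra.
Qed.

Lemma damping_bound f S tau s u : (forall u, 0 <= u <= 1 -> Rabs (Derive f u) <= S) ->
  0 <= tau -> 0 < 1 - tau * S -> 0 <= u <= 1 -> Rabs (damping f tau s u) <= Rabs s * (1 + tau * S).
Proof.
  intros hS ht h hu. unfold damping. rewrite Rabs_mult. apply Rmult_le_compat_l; [apply Rabs_pos|].
  assert (Q := damping_lower f S tau u hS ht hu). rewrite Rabs_right; lra.
Qed.

Section Speeds.

Variables (f : R -> R) (a S : R) (sg : R -> R).
Hypothesis nl : nonlin f a S.
Hypothesis S_pos : 0 < S.
Hypothesis sg_profile : forall tau, 0 <= tau -> tau * S < 1 ->
  exists p, profile f (damping f tau (sg tau)) p.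

(** Since 1 - tau f' > 0 on [0,1], any [s] other than [sg tau] gives dampings strictly ordered at
    every state, which the comparison excludes. *)
Lemma wave_speed tau s U W : 0 <= tau -> tau * S < 1 ->
  wave f (damping f tau s) U W -> s = sg tau.
Proof.
  intros ht hS wv. destruct (sg_profile tau ht hS) as [p pf].
  assert (B : forall u, 0 <= u <= 1 -> Rabs (damping f tau s u) <= Rabs s * (1 + tau * S)).
  { intros u hu. apply damping_bound; [apply nl|exact ht|lra|exact hu]. }
  destruct (Rtotal_order s (sg tau)) as [h|[h|h]]; [exfalso|exact h|exfalso].
  - apply (wave_profile_lt _ _ _ _ _ _ _ _ _ nl wv pf B). intros u hu. unfold damping.
    assert (Q := damping_lower f S tau u (nl_bound _ _ _ nl) ht hu). apply Rmult_lt_compat_r; lra.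
  - apply (wave_profile_gt _ _ _ _ _ _ _ _ _ nl wv pf B). intros u hu. unfold damping.
    assert (Q := damping_lower f S tau u (nl_bound _ _ _ nl) ht hu). apply Rmult_lt_compat_r; lra.
Qed.

(* Two speeds [s < t] at nearby delays would order the two damping coefficients pointwise. *)
Lemma speed_continuous tau e : 0 <= tau -> tau * S < 1 -> 0 < e ->
  exists d, 0 < d /\ forall tau1, 0 <= tau1 -> tau1 * S < 1 -> Rabs (tau1 - tau) < d ->
    Rabs (sg tau1 - sg tau) < e.
Proof.
  intros ht hS he. destruct (sg_profile tau ht hS) as [p pf].
  destruct (profile_wave _ _ _ _ _ nl pf) as [U wv].
  set (s := sg tau) in *. assert (Hs := Rabs_pos s).
  (* If [sg tau1] differed from [s] by at least [e], the factor 1 - tau1 f' >= eta/2 would separate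
     the dampings by e eta/2. The radius ensures this factor through d S <= eta/2; through d S <=
     d1, replacing tau by tau1 in the damping with speed [s] changes it by less than e eta/2. *)
  set (eta := 1 - tau * S). assert (heta : 0 < eta) by (unfold eta; lra).
  set (d1 := e * eta / (2 * (Rabs s + 1))).
  assert (hd1 : 0 < d1) by (apply Rdiv_lt_0_compat; [now apply Rmult_lt_0_compat|lra]).
  assert (E1 : (Rabs s + 1) * d1 = e * (eta / 2)) by (unfold d1; field; lra).
  set (d := Rmin (eta / 2) d1 / S).
  assert (hm : 0 < Rmin (eta / 2) d1) by (apply Rmin_glb_lt; lra).
  assert (hd : 0 < d) by (apply Rdiv_lt_0_compat; lra).
  assert (Ed : d * S = Rmin (eta / 2) d1) by (unfold d; field; lra).
  assert (r1 := Rmin_l (eta / 2) d1). assert (r2 := Rmin_r (eta / 2) d1).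
  exists d. split; [exact hd|]. intros tau1 ht1 hS1 hdist.
  destruct (sg_profile tau1 ht1 hS1) as [p1 pf1].
  assert (B : forall u, 0 <= u <= 1 -> Rabs (damping f tau s u) <= Rabs s * (1 + tau * S)).
  { intros u hu. apply damping_bound; [apply nl|exact ht|lra|exact hu]. }
  assert (key : forall u, 0 <= u <= 1 ->
    eta / 2 <= 1 - tau1 * Derive f u /\
    Rabs (s * (1 - tau1 * Derive f u) - s * (1 - tau * Derive f u)) < e * (eta / 2)).
  { intros u hu. assert (hb := nl_bound _ _ _ nl u hu).
    assert (h1 : Rabs ((tau1 - tau) * Derive f u) <= d * S).
    { rewrite Rabs_mult. apply Rmult_le_compat; try apply Rabs_pos; lra. }
    split.
    - assert (Q := damping_lower f S tau u (nl_bound _ _ _ nl) ht hu).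
      apply Rabs_le_between in h1. fold eta in Q. lra.
    - replace (s * (1 - tau1 * Derive f u) - s * (1 - tau * Derive f u))
        with (- (s * ((tau1 - tau) * Derive f u))) by ring.
      rewrite Rabs_Ropp, Rabs_mult. rewrite <- E1.
      apply Rle_lt_trans with (Rabs s * d1).
      + apply Rmult_le_compat_l; lra.
      + apply Rmult_lt_compat_r; lra. }
  apply Rabs_def1; apply Rnot_le_lt; intros hle.
  - apply (wave_profile_lt _ _ _ _ _ _ _ _ _ nl wv pf1 B). intros u hu. unfold damping.
    destruct (key u hu) as [k1 k2]. apply Rabs_def2 in k2.
    assert (e * (eta / 2) <= e * (1 - tau1 * Derive f u)) by (apply Rmult_le_compat_l; lra).
    assert ((s + e) * (1 - tau1 * Derive f u) <= sg tau1 * (1 - tau1 * Derive f u))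
      by (apply Rmult_le_compat_r; lra). lra.
  - apply (wave_profile_gt _ _ _ _ _ _ _ _ _ nl wv pf1 B). intros u hu. unfold damping.
    destruct (key u hu) as [k1 k2]. apply Rabs_def2 in k2.
    assert (e * (eta / 2) <= e * (1 - tau1 * Derive f u)) by (apply Rmult_le_compat_l; lra).
    assert (sg tau1 * (1 - tau1 * Derive f u) <= (s - e) * (1 - tau1 * Derive f u))
      by (apply Rmult_le_compat_r; lra). lra.
Qed.

End Speeds.

(* [c = speed tau s] inverts [s = c / sqrt (1 - c^2 tau)]. *)
Definition speed (tau s : R) : R := s / sqrt (1 + tau * (s * s)).

Lemma speed_0 s : speed 0 s = s.
Proof.
  unfold speed. replace (1 + 0 * (s * s)) with 1 by ring. rewrite sqrt_1. field.
Qed.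

Lemma speed_radicand_pos tau s : 0 <= tau -> 0 < 1 + tau * (s * s).
Proof.
  intros ht. assert (0 <= tau * (s * s)); [|lra]. apply Rmult_le_pos; [lra|apply (Rle_0_sqr s)].
Qed.

Lemma speed_sqr tau s : 0 <= tau -> 1 - speed tau s * speed tau s * tau = / (1 + tau * (s * s)).
Proof.
  intros ht. assert (h := speed_radicand_pos tau s ht). unfold speed.
  assert (E := sqrt_sqrt (1 + tau * (s * s)) ltac:(lra)).
  assert (hq := sqrt_lt_R0 _ h). set (q := sqrt (1 + tau * (s * s))) in *. rewrite <- E.
  replace (1 - s / q * (s / q) * tau) with ((q * q - tau * (s * s)) / (q * q)) by (field; lra).
  rewrite E at 1. field. lra.
Qed.

Lemma speed_inverse tau c : 0 < 1 - c * c * tau -> speed tau (c / sqrt (1 - c * c * tau)) = c.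
Proof.
  intros h. unfold speed.
  assert (E := sqrt_sqrt (1 - c * c * tau) ltac:(lra)).
  assert (hr := sqrt_lt_R0 _ h). set (r := sqrt (1 - c * c * tau)) in *.
  replace (1 + tau * (c / r * (c / r))) with ((/ r) * (/ r)).
  - rewrite sqrt_square; [field; lra|]. left. now apply Rinv_0_lt_compat.
  - replace (1 + tau * (c / r * (c / r))) with ((r * r + c * c * tau) * (/ r * / r)) by (field; lra).
    rewrite E. ring.
Qed.

Lemma subcharacteristic tau c : 0 < tau ->
  (- (1 / sqrt tau) < c < 1 / sqrt tau <-> 0 < 1 - c * c * tau).
Proof.
  intros ht. assert (hq := sqrt_lt_R0 _ ht). assert (E := sqrt_sqrt tau ltac:(lra)).
  set (q := sqrt tau) in *.
  assert (Ec : c * c * tau = (c * q) * (c * q)) by (rewrite <- E; ring).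
  rewrite Ec. replace (- (1 / q)) with (-1 / q) by (field; lra). split.
  - intros [h1 h2]. apply Rlt_div_l in h1; [|lra]. apply Rlt_div_r in h2; [|lra]. nra.
  - intros h. split; [apply Rlt_div_l|apply Rlt_div_r]; nra.
Qed.

Lemma filterlim_Rmult {T : Type} {F : (T -> Prop) -> Prop} {FF : Filter F} (phi psi : T -> R) (x y : R) :
  filterlim phi F (locally x) -> filterlim psi F (locally y) ->
  filterlim (fun t => phi t * psi t) F (locally (x * y)).
Proof.
  intros h1 h2. apply (filterlim_comp_2 phi psi Rmult h1 h2).
  apply (@filterlim_mult R_AbsRing x y).
Qed.

Lemma filterlim_speed {F : (R -> Prop) -> Prop} {FF : Filter F} (sg : R -> R) (tau s : R) :
  0 <= tau -> filterlim (fun t => t) F (locally tau) -> filterlim sg F (locally s) ->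
  filterlim (fun t => speed t (sg t)) F (locally (speed tau s)).
Proof.
  intros ht h1 h2. assert (h := speed_radicand_pos tau s ht).
  apply filterlim_Rdiv.
  - assert (hq := sqrt_lt_R0 _ h). lra.
  - exact h2.
  - apply (filterlim_comp _ _ _ (fun t => 1 + t * (sg t * sg t)) sqrt _ (locally (1 + tau * (s * s)))).
    + apply filterlim_Rplus; [apply filterlim_const|]. apply filterlim_Rmult; [exact h1|].
      now apply filterlim_Rmult.
    + apply continuous_sqrt.
Qed.

Lemma front_properties (f : R -> R) (a L tau s : R) (p U V : R -> R) :
  nonlin f a L -> 0 <= tau -> tau * L < 1 -> profile f (damping f tau s) p ->
  hyp_front f tau (speed tau s) U V ->
  (forall x y, x < y -> U x < U y) /\ (forall x, 0 < U x /\ 0 < V x) /\ exp_converges U V.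
Proof.
  intros nl ht hL pf hf. set (c := speed tau s) in *.
  assert (hrad := speed_radicand_pos tau s ht).
  assert (hk : 0 < 1 - c * c * tau).
  { unfold c. rewrite speed_sqr by exact ht. now apply Rinv_0_lt_compat. }
  set (k := 1 - c * c * tau) in *.
  assert (hr : 0 < sqrt k) by now apply sqrt_lt_R0.
  assert (hrr : sqrt k * sqrt k = k) by (apply sqrt_sqrt; lra).
  (* The rescaled speed is again [s], so the wave and the profile have the same damping and
     [wave_profile_eq] applies. *)
  assert (Es : c / sqrt k = s).
  { unfold k, c. rewrite speed_sqr, sqrt_inv by exact ht. unfold speed. field.
    assert (hq := sqrt_lt_R0 _ hrad). lra. }
  assert (wv := hyp_front_wave f a L tau c U V nl hk hf). fold k in wv. rewrite Es in wv.
  set (r := sqrt k) in *.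
  assert (B : forall u, 0 <= u <= 1 -> Rabs (damping f tau s u) <= Rabs s * (1 + tau * L)).
  { intros u hu. apply damping_bound; [apply nl|exact ht|lra|exact hu]. }
  assert (h01 := wave_strict01 _ _ _ _ _ _ _ nl wv B). simpl in h01.
  assert (hW := wave_profile_eq _ _ _ _ _ _ _ _ _ nl wv pf B (fun _ _ => eq_refl)). simpl in hW.
  assert (resc : forall x, r * (x / r) = x) by (intros x; field; lra).
  assert (u01 : forall x, 0 < U x < 1).
  { intros x. rewrite <- (resc x). apply h01. }
  assert (DU : forall x, r * Derive U x = p (U x)).
  { intros x. specialize (hW (x / r)). now rewrite resc in hW. }
  assert (DUpos : forall x, 0 < Derive U x).
  { intros x. assert (Q := pf_pos _ _ _ pf (U x) (u01 x)). rewrite <- DU in Q. nra. }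
  assert (Vpos : forall x, 0 < V x).
  { destruct hf as (h & l1 & l2 & l3 & l4).
    apply (flux_pos f a L tau c k U (Derive U) V nl ht hk); auto.
    - intros x. now apply (hyp_front_U f tau c U V).
    - intros x. now apply (hyp_front_V f tau c U V).
    - intros x. now apply (hyp_front_V_eq f tau c U V). }
  split; [|split].
  - intros x y hxy. destruct (MVT_open U (Derive U) x y hxy) as (z & hz & E).
    { intros z _. eapply is_derive_continuous, hyp_front_U, hf. }
    { intros z _. eapply hyp_front_U, hf. }
    specialize (DUpos z). nra.
  - intros x. split; [apply u01|apply Vpos].
  - destruct (exp_decay f a L _ p (fun y => U (r * y)) nl pf) as (kappa & hkappa & e1 & e2).
    { intros x. rewrite <- hW. apply wv. }
    { exact h01. }
    destruct (pf_lip _ _ _ pf) as [K hK].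
    assert (HK := Rabs_pos K). assert (Hc := Rabs_pos c).
    assert (L0 : 0 <= L) by (apply Rle_trans with (2 := nl_bound _ _ _ nl 0 ltac:(lra)), Rabs_pos).
    (* V = r p(U) - c tau f(U) is bounded by [C - 1] times the distance of U to the end state, by
       the Lipschitz constants of p and f; the remaining 1 accounts for U itself. *)
    set (C := 1 + (r * Rabs K + Rabs c * tau * L)).
    assert (hct : 0 <= Rabs c * tau) by now apply Rmult_le_pos.
    assert (hcl : 0 <= Rabs c * tau * L) by now apply Rmult_le_pos.
    assert (hrK : 0 <= r * Rabs K) by (apply Rmult_le_pos; lra).
    assert (hC : 0 < C) by (unfold C; lra).
    assert (VE : forall x, V x = r * p (U x) - c * tau * f (U x)).
    { intros x. rewrite (hyp_front_V_eq f tau c U V hf x). fold k. rewrite <- hrr, <- DU. ring. }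
    assert (Vb : forall x w, 0 <= w -> Rabs (p (U x)) <= Rabs K * w -> Rabs (f (U x)) <= L * w ->
      Rabs (V x) <= (C - 1) * w).
    { intros x w hw b1 b2. rewrite VE. apply Rle_trans with (1 := Rabs_triang _ _).
      rewrite Rabs_Ropp, !Rabs_mult, (Rabs_right r), (Rabs_right tau) by lra.
      assert (r * Rabs (p (U x)) <= r * (Rabs K * w)) by (apply Rmult_le_compat_l; lra).
      assert (Rabs c * tau * Rabs (f (U x)) <= Rabs c * tau * (L * w)) by (apply Rmult_le_compat_l; lra).
      unfold C. lra. }
    assert (p0 := pf_le0 _ _ _ pf 0 ltac:(lra)). assert (p1 := pf_ge1 _ _ _ pf 1 ltac:(lra)).
    exists C, (kappa / r). split; [exact hC|]. split; [now apply Rdiv_lt_0_compat|]. split.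
    + intros x hx. specialize (u01 x).
      assert (Ux : U x <= exp (kappa / r * x)).
      { assert (hxr : x / r <= 0) by (apply Rle_div_l; lra).
        specialize (e1 (x / r) hxr). rewrite resc in e1.
        now replace (kappa / r * x) with (kappa * (x / r)) by (field; lra). }
      assert (Q : Rabs (V x) <= (C - 1) * U x).
      { apply Vb; [lra| |].
        - specialize (hK (U x) 0). rewrite p0, !Rminus_0_r, (Rabs_right (U x)) in hK by lra.
          apply Rle_trans with (1 := hK). apply Rmult_le_compat_r; [lra|apply Rle_abs].
        - apply (nonlin_bound0 f a L); auto. lra. }
      rewrite (Rabs_right (U x)) by lra.
      apply Rle_trans with (C * U x); [lra|]. apply Rmult_le_compat_l; lra.
    + intros x hx. specialize (u01 x).
      assert (Ux : 1 - U x <= exp (- (kappa / r * x))).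
      { assert (hxr : 0 <= x / r) by (apply Rle_div_r; lra).
        specialize (e2 (x / r) hxr). rewrite resc in e2.
        now replace (kappa / r * x) with (kappa * (x / r)) by (field; lra). }
      assert (Q : Rabs (V x) <= (C - 1) * (1 - U x)).
      { apply Vb; [lra| |].
        - specialize (hK (U x) 1). rewrite p1, Rminus_0_r, (Rabs_minus_sym (U x)), (Rabs_right (1 - U x)) in hK by lra.
          apply Rle_trans with (1 := hK). apply Rmult_le_compat_r; [lra|apply Rle_abs].
        - apply (nonlin_bound1 f a L); auto. lra. }
      rewrite Rabs_minus_sym, (Rabs_right (1 - U x)) by lra.
      apply Rle_trans with (C * (1 - U x)); [lra|]. apply Rmult_le_compat_l; lra.
Qed.

Theorem theorem1p1 (f : R -> R) (alpha : R) :
  smooth f -> bistable f alpha ->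
  exists cstar : R -> R,
    (forall tau, 0 < tau < tau_m f ->
       - (1 / sqrt tau) < cstar tau < 1 / sqrt tau /\
       (exists U V, hyp_front f tau (cstar tau) U V) /\
       (forall c U V, - (1 / sqrt tau) < c < 1 / sqrt tau ->
          hyp_front f tau c U V -> c = cstar tau) /\
       (forall U V, hyp_front f tau (cstar tau) U V ->
          (forall x y, x < y -> U x < U y) /\
          (forall x, 0 < U x /\ 0 < V x) /\
          exp_converges U V)) /\
    (forall tau, 0 < tau < tau_m f -> continuous cstar tau) /\
    (exists c0 : R,
       (exists U, parabolic_front f c0 U) /\
       (forall c U, parabolic_front f c U -> c = c0) /\
       filterlim cstar (at_right 0) (locally c0)).
Proof.
  intros hs hb. assert (nl := bistable_nonlin f alpha hs hb).
  unfold tau_m. set (S := real (sup_abs_deriv01 f)) in *.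
  assert (S_pos : 0 < S).
  { assert (d0 := nl_d0 _ _ _ nl). assert (Q := nl_bound _ _ _ nl 0 ltac:(lra)).
    apply Rabs_le_between in Q. lra. }
  assert (htS : forall tau, tau < 1 / S -> tau * S < 1).
  { intros tau h. apply Rlt_div_r in h; lra. }
  destruct (choice _ _ (fun tau s => 0 <= tau -> tau * S < 1 -> exists p, profile f (damping f tau s) p))
    as [sg hsg].
  { intros tau. destruct (classic (0 <= tau /\ tau * S < 1)) as [[ht hS]|hn].
    - destruct (profile_exists f alpha S (fun u => 1 - tau * Derive f u) (1 - tau * S) (1 + tau * S) nl)
        as (s & p & pf).
      + intros u. apply (continuous_minus (fun _ => 1) (fun u => tau * Derive f u)); [apply continuous_const|].
        apply (continuous_scal_r tau (Derive f)). now apply smooth_continuous_Derive.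
      + lra.
      + intros u hu. apply damping_lower; auto. apply nl.
      + exists s. intros _ _. now exists p.
    (* Outside the admissible range the condition is void and 0 is a filler. *)
    - exists 0. intros h1 h2. exfalso. now apply hn. }
  (* An arbitrary filter covers both the continuity at tau > 0 and the limit as tau decreases to
     0. *)
  assert (near : forall (F : (R -> Prop) -> Prop) (FF : Filter F) tau, 0 <= tau -> tau * S < 1 ->
    filterlim (fun t => t) F (locally tau) -> F (fun t => 0 <= t) -> F (fun t => t * S < 1) ->
    filterlim (fun t => speed t (sg t)) F (locally (speed tau (sg tau)))).
  { intros F FF tau ht hS hid F0 F1. apply filterlim_speed; auto.
    apply filterlim_locally. intros e.
    destruct (speed_continuous f alpha S sg nl S_pos hsg tau e ht hS (cond_pos e)) as (d & hd & Q).
    assert (Fd := proj1 (filterlim_locally (fun t => t) tau) hid (mkposreal d hd)).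
    generalize (filter_and _ _ Fd (filter_and _ _ F0 F1)). apply filter_imp.
    intros t (h1 & h2 & h3). exact (Q t h2 h3 h1). }
  exists (fun tau => speed tau (sg tau)). split; [|split].
  - intros tau [ht htm]. specialize (htS tau htm). destruct (hsg tau ltac:(lra) htS) as [p pf].
    split; [|split; [|split]].
    + apply (subcharacteristic tau); [exact ht|]. rewrite speed_sqr by lra.
      apply Rinv_0_lt_compat, speed_radicand_pos. lra.
    + destruct (profile_wave _ _ _ _ _ nl pf) as [U wv].
      exact (wave_hyp_front _ _ _ _ _ _ _ nl (Rlt_le _ _ ht) wv).
    + intros c U V hc hf. apply (subcharacteristic tau c ht) in hc.
      (* The rescaled speed of any front is [sg tau], and [speed tau] inverts the rescaling. *)
      assert (wv := hyp_front_wave f alpha S tau c U V nl hc hf).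
      rewrite <- (wave_speed f alpha S sg nl hsg _ _ _ _ (Rlt_le _ _ ht) htS wv).
      symmetry. now apply speed_inverse.
    + intros U V hf. apply (front_properties f alpha S tau (sg tau) p); auto. lra.
  - intros tau [ht htm]. apply (near (locally tau) _ tau).
    + lra.
    + now apply htS.
    + apply filterlim_id.
    + apply filter_imp with (fun t => 0 < t); [intros t h; lra|now apply locally_gt].
    + apply filter_imp with (fun t => t < 1 / S); [apply htS|now apply locally_lt].
  - assert (h0 : 0 * S < 1) by lra. destruct (hsg 0 ltac:(lra) h0) as [p pf].
    assert (hS' : 0 < 1 / S) by (apply Rdiv_lt_0_compat; lra).
    exists (sg 0). split; [|split].
    + destruct (profile_wave _ _ _ _ _ nl pf) as [U wv]. exists U.
      assert (E : forall x, Derive U x = p (U x)) by (intros x; apply is_derive_unique, wv).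
      assert (d2 : forall x, is_derive (Derive U) x (- damping f 0 (sg 0) (U x) * p (U x) - f (U x))).
      { intros x. apply (is_derive_ext (fun x => p (U x))); [intros t; now rewrite E|]. apply wv. }
      split; [|split; apply wv]. intros x. split; [|split].
      * eexists; apply wv.
      * eexists; apply d2.
      * rewrite (is_derive_unique _ _ _ (d2 x)), E. unfold damping. ring.
    + intros c U hf. apply (parabolic_wave f alpha S c U nl) in hf.
      exact (wave_speed f alpha S sg nl hsg _ _ _ _ (Rle_refl 0) h0 hf).
    + rewrite <- (speed_0 (sg 0)) at 1. apply (near (at_right 0) _ 0); [lra|exact h0| | |].
      * intros P HP. now apply filter_le_within.
      * exists (mkposreal 1 Rlt_0_1). intros t _ h. lra.
      * apply filter_imp with (fun t => t < 1 / S); [apply htS|]. apply filter_le_within.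
        now apply locally_lt.
Qed.
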